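(* Let $d\ge 2$ be a fixed integer. For prime powers $q$ such that $\gcd(d-1,q)=1$ and $e=\gcd(d,q-1)\ge 2$, we have $$ N_d(q)\ge q^{\rho_{d,e}+o(1)}\qquad\text{as } q\to\infty, $$ where $$ \rho_{d,e}=\frac{1}{2\left(e-1+\log d/\log e\right)}. $$
   Context: For a function $f:\mathbb{F}_q\to\mathbb{F}_q$, the functional graph $\mathcal{G}_f$ is the directed graph on the vertex set $\mathbb{F}_q$ with an edge from $u$ to $v$ if and only if $f(u)=v$ (loops allowed). $N_d(q)$ denotes the number of pairwise non-isomorphic (as directed graphs) functional graphs $\mathcal{G}_f$ generated by all polynomials $f\in\mathbb{F}_q[X]$ of degree exactly $d$. The term $o(1)$ tends to $0$ as $q\to\infty$ through the admissible prime powers, for the fixed $d$. *)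

(* Defs.v *)
From HB Require Import structures.
From mathcomp Require Import all_boot all_order all_algebra all_fingroup.
From mathcomp Require Import qpoly.
From mathcomp Require Import all_classical all_reals all_analysis.

Set Implicit Arguments.
Unset Strict Implicit.
Unset Printing Implicit Defensive.

Import Order.TTheory GRing.Theory Num.Theory.

Local Open Scope ring_scope.

(* A directed graph (loops allowed) on the vertex set V is given by its set of
   edges. *)
Definition digraph (V : finType) := {set V * V}.

Definition digraph_iso (V : finType) (G H : digraph V) : bool :=
  [exists s : {perm V}, forall u : V, forall v : V,
    ((s u, s v) \in H) == ((u, v) \in G)].

(* The classes of [equivalence_partition] are meaningful only because of this
   fact. *)
Lemma digraph_iso_equiv (V : finType) : equivalence_rel (@digraph_iso V).
Proof.
have isoP (G H : digraph V) : reflect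
    (exists s : {perm V}, forall u v, ((s u, s v) \in H) = ((u, v) \in G))
    (digraph_iso G H).
  apply: (iffP existsP) => -[s Hs]; exists s.
    by move=> u v; apply/eqP; move/forallP: Hs => /(_ u)/forallP.
  by apply/forallP => u; apply/forallP => v; apply/eqP.
have isoT (G H K : digraph V) : digraph_iso G H -> digraph_iso H K -> digraph_iso G K.
  move=> /isoP[s Hs] /isoP[t Ht]; apply/isoP; exists (s * t)%g => u v.
  by rewrite !permM Ht Hs.
have isoS (G H : digraph V) : digraph_iso G H -> digraph_iso H G.
  move=> /isoP[s Hs]; apply/isoP; exists s^-1%g => u v.
  by rewrite -Hs !permKV.
move=> G H K; split.
  by apply/isoP; exists 1%g => u v; rewrite !perm1.
by move=> GH; apply/idP/idP; apply: isoT => //; apply: isoS.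
Qed.

Definition functional_graph (V : finType) (f : V -> V) : digraph V :=
  [set uv : V * V | f uv.1 == uv.2]%SET.

(* [{poly_d.+1 F}] is the finite type of polynomials p with size p <= d.+1;
   size p = d.+1 means degree exactly d. *)
Definition poly_graphs (F : finFieldType) (d : nat) : {set digraph F} :=
  [set functional_graph (horner (p : {poly F}))
    | p : {poly_d.+1 F} & size (p : {poly F}) == d.+1]%SET.

(* N_d(q) for q = #|F|. *)
Definition num_poly_graphs (F : finFieldType) (d : nat) : nat :=
  #|equivalence_partition (@digraph_iso F) (poly_graphs F d)|.

Definition admissible (d q : nat) : Prop :=
  [/\ exists p k : nat, [/\ prime p, (0 < k)%N & q = (p ^ k)%N],
      gcdn d.-1 q = 1%N
    & (2 <= gcdn d q.-1)%N].

Definition rho (R : realType) (d e : nat) : R :=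
  1 / (2 * (e%:R - 1 + ln d%:R / ln e%:R)).

(* Main.v *)
Require Import Defs.
From HB Require Import structures.
From mathcomp Require Import all_boot all_order all_algebra.
From mathcomp Require Import all_fingroup all_solvable all_field.
From mathcomp Require Import polyXY qpoly zify ring lra.
From mathcomp Require Import all_classical all_reals all_analysis.

(* Write F_0 = 0 and F_(k+1) = F_k^d + a. In the graph of X^d + a, the vertex 0 is
   the only one that is alone in its fibre, so an isomorphism between the graphs
   of X^d + a and X^d + b maps F_k(a) to F_k(b) for all k. The fibre of F_(n+2)
   consists of the z F_(n+1) with z^e = 1, and z F_(n+1) has a preimage iff
   z F_(n+1) - a is an e-th power. Hence the number of z <> 1 for which this
   happens is, for every n, an invariant with values in {0, ..., e-1}.

   A character sum argument shows that, for N consecutive n, all e^N combinations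
   of values occur once e^((e-1)N) d^N is at most a constant times sqrt q; the
   largest such N yields the exponent rho. The character sums are bounded by
   O(degree * sqrt q) with Stepanov's method, in the form with Hasse derivatives.

   What remains is that no nontrivial product of powers, with exponents below e,
   of the polynomials g = z F_(n+1) - X is an e-th power. The multiple roots of g
   are controlled by X g' - g = z F_n^(d-1) (d X F_n' - F_n), where the second
   factor is nonzero because d - 1 is prime to q. Counting roots then suffices
   for d >= 3; for d = 2 a Pell type equation F_n^2 + 2X = S T^2 with S of small
   degree is left, and is excluded by no_square_cofactor below. *)

Set Implicit Arguments.
Unset Strict Implicit.
Unset Printing Implicit Defensive.

Import Order.TTheory GRing.Theory Num.Theory.
Import numFieldNormedType.Exports.
Local Open Scope ring_scope.

(** * Common factors of binomials *)

Lemma fraction_repr (R : idomainType) (x : {fraction R}) :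
  exists a b : R, b != 0 /\ FracField.tofrac b * x = FracField.tofrac a.
Proof.
elim/quotW: x => x; exists (frac x).1, (frac x).2; split; first exact: denom_ratioP.
unlock FracField.tofrac; rewrite -[LHS]FracField.pi_mul; apply/eqmodP.
rewrite /= /FracField.equivf /= /FracField.mulf.
by rewrite !numden_Ratio ?mulf_neq0 ?oner_neq0 ?denom_ratioP // !mul1r mulr1 mulrC.
Qed.

(* The determinant of the companion matrix of a monic factor of [X^r - w] is an
   r-th root of a power of [w]. *)
Lemma monic_dvd_binomial (L : fieldType) (P : {poly L}) (r : nat) (w : L) :
  P \is monic -> (1 < size P)%N -> P %| 'X^r - w%:P ->
  exists x : L, x ^+ r = w ^+ (size P).-1.
Proof.
move=> Pm Psz /dvdpP[Q PQ].
have [b bE] : exists b, (size P).-1 = b.+1 by exists (size P).-2; lia.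
move: (companionmx P) (companionmxK Pm); rewrite bE => C CP.
exists (\det C); rewrite -[LHS]/(_ ^+ _).
have : horner_mx C ('X^r - w%:P) = 0.
  by rewrite PQ rmorphM /= -CP Cayley_Hamilton mulr0.
rewrite rmorphB rmorphXn /= horner_mx_X horner_mx_C => /eqP.
rewrite subr_eq0 => /eqP/(congr1 determinant); rewrite det_scalar => <-.
by elim: (r) => [|k IH]; rewrite ?expr0 ?det1 // !exprS det_mulmx IH.
Qed.

(** Over the fraction field of [{poly K}] the monic associate of [P] divides ['X^r - c / W], so
    [(c / W) ^ deg P] is an r-th power there; clearing denominators gives the relation with
    [k = c ^ deg P]. It contradicts [no_power_relation] once [deg P < r]. *)
Lemma dvd_binomial_exp (K : fieldType) (r : nat) (W : {poly K}) (c : K)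
    (P : {poly {poly K}}) :
  (0 < r)%N -> c != 0 -> W != 0 -> (1 < size P)%N -> P %| W *: 'X^r - c%:P%:P ->
  exists A B : {poly K}, exists2 k : K, k != 0 &
    [/\ A != 0, B != 0 & A ^+ r * W ^+ (size P).-1 = k *: B ^+ r].
Proof.
move=> r0 c0 W0 Psz /Pdiv.Idomain.dvdpP[[a Q] /= a0 PQ].
have [L [f [f_inj fP]]] : exists L : fieldType, exists f : {rmorphism {poly K} -> L},
    injective f /\ forall x, exists a b, b != 0 /\ f b * x = f a.
  exists {fraction {poly K}}, (@FracField.tofrac _); split; last exact: fraction_repr.
  by move=> x y /eqP; rewrite tofrac_eq => /eqP.
have f0 x : (f x == 0) = (x == 0) by rewrite -(inj_eq f_inj) rmorph0.
pose P1 := map_poly f P.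
have sP1 : size P1 = size P by rewrite size_map_inj_poly ?rmorph0.
pose P2 := (lead_coef P1)^-1 *: P1.
have P10 : P1 != 0 by rewrite -size_poly_eq0 sP1; lia.
have l0 : lead_coef P1 != 0 by rewrite lead_coef_eq0.
have sP2 : size P2 = size P by rewrite size_scale ?invr_eq0.
have P2m : P2 \is monic by rewrite monicE lead_coefZ mulVf.
have P2d : P2 %| 'X^r - (f c%:P / f W)%:P.
  rewrite dvdpZl ?invr_eq0 //.
  have aW0 : f a * f W != 0 by rewrite mulf_neq0 ?f0.
  rewrite -(dvdpZr _ _ aW0).
  move/(congr1 (map_poly f)): PQ; rewrite rmorphM /= map_polyZ rmorphB /=.
  rewrite map_polyZ /= map_polyXn map_polyC /= => PQ.
  apply/dvdpP; exists (map_poly f Q); rewrite -PQ -scalerA; congr (_ *: _).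
  rewrite scalerBr; congr (_ - _).
  by rewrite -mul_polyC -polyCM mulrC mulfVK ?f0.
have P2s : (1 < size P2)%N by rewrite sP2.
have [x] := monic_dvd_binomial P2m P2s P2d.
have [A [B [B0 BA]]] := fP x.
rewrite sP2; set b := (size P).-1 => xE.
have c0' : f c%:P != 0 by rewrite f0 polyC_eq0.
have w0 : f c%:P / f W != 0.
  by apply: mulf_neq0 => //; rewrite invr_eq0 f0.
have x0 : x != 0.
  apply/eqP => x0; move/eqP: xE; rewrite x0 expr0n gtn_eqF //= eq_sym.
  by rewrite (negPf (expf_neq0 _ w0)).
have A0 : A != 0.
  by rewrite -f0 -BA mulf_neq0 // f0.
exists A, B, (c ^+ b); [by rewrite expf_neq0 | split => //].
apply: f_inj; rewrite -mul_polyC rmorphM /= !rmorphXn /= -BA exprMn xE.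
rewrite expr_div_n -mulrA mulfVK ?expf_neq0 ?f0 //.
by rewrite rmorphM /= !rmorphXn /= mulrC.
Qed.

(** Each term of the Leibniz expansion contains exactly one entry of every row. *)
Lemma size_det_leq (R : idomainType) (n : nat) (M : 'M[{poly R}]_n) (a : 'I_n -> nat) :
  (forall i j, (size (M i j) <= (a i).+1)%N) ->
  (size (\det M) <= (\sum_i a i).+1)%N.
Proof.
move=> Ma; rewrite /determinant; apply: (leq_trans (size_sum _ _ _)).
apply/bigmax_leqP => s _; rewrite mulr_sign; case: ifP => _.
  rewrite size_polyN.
  all: apply: (leq_trans (size_poly_prod_leq _ _)).
all: rewrite leq_subLR addnS ltnS -sum1_card -big_split /=.
all: by apply: leq_sum => i _; rewrite add1n.
Qed.

Lemma size_resultant_leq (R : idomainType) (p q : {poly {poly R}}) (a b : nat) :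
  (forall i, (size (p`_i)%R <= a.+1)%N) -> (forall i, (size (q`_i)%R <= b.+1)%N) ->
  (size (resultant p q) <= ((size q).-1 * a + (size p).-1 * b).+1)%N.
Proof.
move=> pa qb; rewrite /resultant.
pose w (i : 'I_((size q).-1 + (size p).-1)) := if fintype.split i is inl _ then a else b.
apply: (@leq_trans (\sum_i w i).+1).
  apply: size_det_leq => i j; rewrite Sylvester_mxE /w.
  by case: (fintype.split i) => k; case: (k <= j)%N; rewrite ?mulr1n ?mulr0n ?size_poly0.
rewrite ltnS big_split_ord /=.
rewrite (eq_bigr (fun=> a)) => [|i _]; last by rewrite /w (unsplitK (inl i)).
rewrite [X in (_ + X <= _)%N](eq_bigr (fun=> b)) => [|i _]; last first.
  by rewrite /w (unsplitK (inr i)).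
by rewrite !sum_nat_const !card_ord.
Qed.

(** Raising to the power [q] is additive, so the difference equals [(W - W(x)) ^ q]. *)
Lemma XsubC_exp_pchar (K : fieldType) (q : nat) (W : {poly K}) (x : K) :
  [pchar K].-nat q -> ('X - x%:P) ^+ q %| W ^+ q - (W.[x] ^+ q)%:P.
Proof.
move=> qK; have qP : [pchar {poly K}].-nat q.
  by rewrite (eq_pnat _ (pchar_poly K)).
have -> : W ^+ q - (W.[x] ^+ q)%:P = (W - W.[x]%:P) ^+ q.
  apply/eqP; rewrite subr_eq polyC_exp -exprDn_pchar // subrK //.
by apply: dvdp_exp2r; rewrite dvdp_XsubCl rootE !hornerE subrr.
Qed.

(* Weaker than, and sufficient for, the irreducibility of [W Y^r - c] over the
   field of rational functions. *)
Definition no_power_relation (K : fieldType) (r : nat) (W : {poly K}) :=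
  forall (b : nat) (A B : {poly K}) (k : K), (0 < b < r)%N -> k != 0 ->
    A != 0 -> B != 0 -> A ^+ r * W ^+ b <> k *: B ^+ r.

(* The resultant in [Y] of [\sum_i k_i Y^i] and [W Y^r - W(x0)^q] is divisible by
   [(X - x0)^q], since both vanish at [Y = W^c] modulo it, but its degree is below
   [q]; so it is zero and the two polynomials have a common factor. *)
Lemma low_degree_independence (K : fieldType) (q r c m a : nat) (W : {poly K})
    (x0 : K) (k : 'I_r -> {poly K}) :
  [pchar K].-nat q -> no_power_relation r W -> (r * c).+1 = q ->
  W.[x0] != 0 -> (size W <= m.+1)%N -> (forall i, size (k i) <= a.+1)%N ->
  (r * (a + m) < q)%N -> (0 < r)%N ->
  ('X - x0%:P) ^+ q %| \sum_(i < r) k i * W ^+ (i * c) -> forall i, k i = 0.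
Proof.
move=> qK nW rc W0 Wm ka ramq r0 dvdk.
pose P : {poly {poly K}} := \sum_(i < r) k i *: 'X^i.
have Pi (i : 'I_r) : P`_i = k i.
  rewrite coef_sum (bigD1 i) //= big1 ?addr0 => [|j ji].
    by rewrite coefZ coefXn eqxx mulr1.
  by rewrite coefZ coefXn (inj_eq val_inj) eq_sym (negPf ji) mulr0.
have Psz : (size P <= r)%N.
  apply: (leq_trans (size_sum _ _ _)); apply/bigmax_leqP => i _.
  by apply: (leq_trans (size_scale_leq _ _)); rewrite size_polyXn.
have Pa i : (size (P`_i)%R <= a.+1)%N.
  have [ir|ri] := ltnP i r; first by rewrite -[i]/(val (Ordinal ir)) Pi.
  by rewrite nth_default ?size_poly0 // (leq_trans Psz).
have PW : P.[W ^+ c] = \sum_(i < r) k i * W ^+ (i * c).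
  rewrite horner_sum; apply: eq_bigr => i _.
  by rewrite hornerZ hornerXn -exprM mulnC.
have szX : size (('X - x0%:P) ^+ q) = q.+1 by rewrite size_exp_XsubC.
have smallP (R : {poly K}) : (size R <= q)%N -> ('X - x0%:P) ^+ q %| R -> R = 0.
  move=> Rq RX; apply/eqP; apply/negP => /negP R0.
  by have := dvdp_leq R0 RX; rewrite szX ltnNge Rq.
suff P0 : P = 0 by move=> i; rewrite -Pi P0 coef0.
apply/eqP/negP => /negP P0.
(* The resultant identity needs positive degree in [Y]. A constant [P] is [k_0], whose degree is at
   most [a < q]. *)
have [P1|P1] := leqP (size P) 1.
  have PC : P = (P`_0)%:P by apply: size1_polyC.
  move: dvdk; rewrite -PW PC hornerC => /smallP R0.
  move/eqP: P0; apply; rewrite PC R0 //.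
  by apply: (leq_trans (Pa 0)); nia.
pose k0 := W.[x0] ^+ q.
have k00 : k0 != 0 by rewrite expf_neq0.
have Wn0 : W != 0 by apply: contraNneq W0 => ->; rewrite horner0.
pose D : {poly {poly K}} := W *: 'X^r - k0%:P%:P.
have Di i : D`_i = W * (i == r)%:R - k0%:P * (i == 0)%:R.
  rewrite coefB coefZ coefXn coefC; case: (i == 0); by rewrite ?mulr1 ?mulr0.
have Dsz : size D = r.+1.
  rewrite /D size_polyDl ?size_polyN size_scale ?size_polyXn //.
  by rewrite ltnS (leq_trans (size_polyC_leq1 _)).
have D0 : D != 0 by rewrite -size_poly_eq0 Dsz.
have Dm i : (size (D`_i)%R <= m.+1)%N.
  rewrite Di (leq_trans (size_polyD _ _)) // geq_max; apply/andP; split.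
    by case: eqP; rewrite ?mulr1 ?mulr0 ?size_poly0.
  rewrite size_polyN; case: eqP; rewrite ?mulr1 ?mulr0 ?size_poly0 //.
  by rewrite (leq_trans (size_polyC_leq1 _)).
have Dgt1 : (1 < size D)%N by rewrite Dsz ltnS.
have [[u v] /= _ Euv] := resultant_in_ideal P1 Dgt1.
have R0 : resultant P D = 0.
  apply: smallP.
    apply: (leq_trans (size_resultant_leq Pa Dm)); rewrite Dsz /=.
    by move: (size P) Psz => s; nia.
  have := congr1 (horner^~ (W ^+ c)) Euv; rewrite hornerC hornerD !hornerM => ->.
  apply: dvdp_add; apply: dvdp_mull; first by rewrite PW.
  rewrite /D !hornerE -exprM -exprS mulnC rc; exact: XsubC_exp_pchar.
move/eqP: R0; rewrite resultant_eq0 => gsz.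
have gD : gcdp P D %| D by exact: dvdp_gcdr.
have [A [B [kk kk0 [A0 B0 AB]]]] := dvd_binomial_exp r0 k00 Wn0 gsz gD.
have gP : (size (gcdp P D) <= size P)%N by exact: leq_gcdpl.
apply: (nW _ A B kk _ kk0 A0 B0 AB).
by move: (size _) (size P) gP gsz Psz => s s'; clear; lia.
Qed.

(** * Hasse derivatives and Stepanov's method *)

Lemma nderivnM (R : comNzRingType) (p q : {poly R}) (l : nat) :
  (p * q)^`N(l) = \sum_(j < l.+1) p^`N(j) * q^`N(l - j).
Proof.
elim/poly_ind: p l => [|p c IH] l.
  by rewrite mul0r linear0 big1 // => j _; rewrite linear0 mul0r.
have -> : (p * 'X + c%:P) * q = (p * q) * 'X + c *: q.
  by rewrite mulrDl mul_polyC mulrAC.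
case: l => [|l]; first by rewrite big_ord1 !nderivn0 mulrDl mul_polyC mulrAC.
have EX s : (s * 'X)^`N(l.+1) = s^`N(l) + s^`N(l.+1) * 'X :> {poly R}.
  by have := nderivnMXaddC l s 0; rewrite polyC0 addr0.
rewrite nderivnD EX nderivnZ !IH [RHS]big_ord_recl nderivn0 subn0 mulrDl mul_polyC.
under [in RHS]eq_bigr => i _ do rewrite lift0 subSS nderivnMXaddC mulrDl.
rewrite big_split /= [X in _ + X * 'X]big_ord_recl nderivn0 subn0 mulrDl mulrAC.
rewrite mulr_suml; under [X in _ + (_ + X) + _]eq_bigr => i _ do rewrite lift0 subSS mulrAC.
by rewrite addrCA addrAC.
Qed.

Lemma size_nderivn (R : nzRingType) (p : {poly R}) (l : nat) :
  (size p^`N(l) <= size p - l)%N.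
Proof. exact: size_poly. Qed.

(* [hasse_cofactor W N l] is the polynomial [b] of degree at most [l * deg W]
   with [(W ^+ N)^`N(l) * W ^+ l = W ^+ N * b]. *)
Fixpoint hasse_cofactor (R : nzRingType) (W : {poly R}) (N l : nat) : {poly R} :=
  if N is N'.+1 then
    \sum_(j < l.+1) (if (j : nat) is j'.+1 then W^`N(j) * W ^+ j' else 1)
                    * hasse_cofactor W N' (l - j)
  else (l == 0)%:R.

Lemma hasse_cofactorP (R : comNzRingType) (W : {poly R}) (N l : nat) :
  (W ^+ N)^`N(l) * W ^+ l = W ^+ N * hasse_cofactor W N l.
Proof.
elim: N l => [|N IH] l /=.
  by rewrite expr0 mul1r nderivnC; case: l => [|l]; rewrite ?mulr1 ?mul0r.
rewrite exprS nderivnM mulr_suml mulr_sumr; apply: eq_bigr => -[j /= jl] _.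
have -> : W ^+ l = W ^+ (l - j) * W ^+ j by rewrite -exprD subnK.
rewrite mulrA -(mulrA _ _ (W ^+ (l - j))) IH.
by case: j jl => [|j] jl; rewrite ?nderivn0 ?exprS; ring.
Qed.

(** The form [a.+1] lets degree bounds add without truncated subtraction and covers the zero
    polynomial. *)
Lemma size_polyM_bound (R : nzRingType) (p q : {poly R}) (a b : nat) :
  (size p <= a.+1)%N -> (size q <= b.+1)%N -> (size (p * q)%R <= (a + b).+1)%N.
Proof. by move=> pa qb; apply: (leq_trans (size_polyMleq _ _)); lia. Qed.

Lemma size_polyX_bound (R : nzRingType) (p : {poly R}) (a n : nat) :
  (size p <= a.+1)%N -> (size (p ^+ n)%R <= (n * a).+1)%N.
Proof. by move=> pa; apply: (leq_trans (size_poly_exp_leq _ _)); nia. Qed.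

Lemma size_hasse_cofactor (R : nzRingType) (W : {poly R}) (m N l : nat) :
  (size W <= m.+1)%N -> (size (hasse_cofactor W N l) <= (l * m).+1)%N.
Proof.
move=> Wm; elim: N l => [|N IH] l /=.
  by case: (l == 0)%N; rewrite ?size_poly1 ?size_poly0.
apply: (leq_trans (size_sum _ _ _)); apply/bigmax_leqP => -[j /= jl] _.
have -> : (l * m = j * m + (l - j) * m)%N by rewrite -mulnDl subnKC.
apply: size_polyM_bound (IH _); case: j jl => [|j] jl; first by rewrite size_poly1.
rewrite mulSn; apply: size_polyM_bound (size_polyX_bound _ Wm).
by apply: (leq_trans (size_nderivn _ _)); lia.
Qed.

(** Taylor expansion at [z]. With Hasse derivatives no factorials are inverted, so [M] may exceed
    the characteristic. *)
Lemma XsubC_exp_dvdP (K : fieldType) (P : {poly K}) (z : K) (M : nat) :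
  (forall l, (l < M)%N -> (P^`N(l)).[z] = 0) -> ('X - z%:P) ^+ M %| P.
Proof.
move=> PM; have : P^:P.[z%:P + ('X - z%:P)] = P.
  by rewrite addrCA subrr addr0; exact: comp_polyXr.
rewrite (nderiv_taylor _ (mulrC _ _)) => <-.
apply: (big_ind (fun Q => ('X - z%:P) ^+ M %| Q)) => [|p q|i _].
- exact: dvdp0.
- exact: dvdp_add.
- have [iM|Mi] := ltnP i M; last by rewrite dvdp_mull // dvdp_exp2l.
  by rewrite nderivn_map horner_map /= PM // polyC0 mul0r.
Qed.

Lemma underdetermined_system (K : fieldType) (I J : finType) (M : I -> J -> K) :
  (#|J| < #|I|)%N ->
  exists2 v : I -> K, exists i, v i != 0 & forall j, \sum_i v i * M i j = 0.
Proof.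
move=> JI; pose A := \matrix_(i < #|I|, j < #|J|) M (enum_val i) (enum_val j).
have : kermx A != 0.
  rewrite -mxrank_eq0 mxrank_ker subn_eq0 -ltnNge.
  by apply: leq_ltn_trans JI; exact: rank_leq_col.
case/rowV0Pn => u /sub_kermxP uA u0.
exists (fun i => u 0 (enum_rank i)).
  have [k uk] := rV0Pn _ u0; exists (enum_val k); by rewrite enum_valK.
move=> j; transitivity ((u *m A) 0 (enum_rank j)); last by rewrite uA mxE.
rewrite mxE [RHS](reindex enum_rank) /=; last by apply/onW_bij/enum_rank_bij.
by apply: eq_bigr => i _; rewrite !mxE !enum_rankK.
Qed.

(** With [J = M %/ r + 2 * m + 4] and [A = c - m], the left side counts the linear conditions of
    [stepanov] and the right side, [r * J * A], its free coefficients. Since [r * J] exceeds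
    [M + r * (2 * m + 3)], there is a surplus of about [(2 * m + 3) * q], which outweighs
    [M * M * m + M * J]. *)
Lemma stepanov_arith (r c m M : nat) :
  (1 < r)%N -> (M * M <= (r * c).+1)%N -> (4 * r * (m + 3) <= M)%N ->
  (M * (M %/ r + 2 * m + 4 + (c - m) + M * m) < r * (M %/ r + 2 * m + 4) * (c - m))%N.
Proof.
move=> r1 Mq Mm.
have Mr : (M < r * (M %/ r) + r)%N.
  by rewrite mulnC {1}(divn_eq M r) ltn_add2l ltn_mod; lia.
have J2 : (2 * (M %/ r) <= M)%N.
  by rewrite {2}(divn_eq M r); nia.
move: (M %/ r)%N Mr J2 => u Mr J2.
have cm : (m <= c)%N by nia.
have [t ct] : exists t, c = (m + t)%N by exists (c - m)%N; lia.
subst c; rewrite addKn {cm}.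
have rJ : (M + r * (2 * m + 3) < r * (u + 2 * m + 4))%N by nia.
apply: (@leq_trans ((M + r * (2 * m + 3)) * t)); last by rewrite leq_mul2r ltnW ?orbT.
have JM : (u + 2 * m + 4 <= M)%N by nia.
have E1 : (M * (u + 2 * m + 4) <= M * M)%N by rewrite leq_mul2l JM orbT.
have MQ : (M <= M * M)%N by rewrite leq_pmulr //; nia.
have rm : (4 * (r * m + 1) <= M)%N by nia.
have X3 : (3 * (M * M) <= 4 * (r * t))%N by move: Mq; rewrite mulnDr; lia.
have E3 : ((2 * m + 3) * (3 * (M * M)) <= (2 * m + 3) * (4 * (r * t)))%N.
  by rewrite leq_mul2l X3 orbT.
have E4 : (24 <= M * M)%N by nia.
move: E3.
have -> : ((2 * m + 3) * (3 * (M * M)) = 6 * (M * M * m) + 9 * (M * M))%N by ring.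
have -> : ((2 * m + 3) * (4 * (r * t)) = 8 * (r * t * m) + 12 * (r * t))%N by ring.
have -> : (M * (u + 2 * m + 4 + t + M * m) = M * (u + 2 * m + 4) + M * t + M * M * m)%N.
  by ring.
have -> : ((M + r * (2 * m + 3)) * t = M * t + (2 * (r * t * m) + 3 * (r * t)))%N.
  by ring.
lia.
Qed.

(** Compares [s] zeros of order [M] with the degree of the auxiliary polynomial. Dividing by [M]
    costs little because [q < (M + 1)^2] gives [q <= M * (M + 2)]. *)
Lemma stepanov_arith_final (r c m M A s : nat) :
  (1 < r)%N -> (A <= c)%N -> (M * M <= (r * c).+1)%N -> ((r * c).+1 < M.+1 * M.+1)%N ->
  (4 * r * (m + 3) <= M)%N ->
  (s * M <= A.-1 + r * c * m + (r * c).+1 * (M %/ r + 2 * m + 4).-1)%N ->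
  (r * s <= (r * c).+1 + r * (3 * m + 4) * (M + 2))%N.
Proof.
move=> r1 Ac Mq qM Mm SM.
have M0 : (0 < M)%N by move: Mm r1; clear; nia.
rewrite -(leq_pmul2l M0).
have Mr : (r * (M %/ r) <= M)%N by rewrite mulnC leq_divM.
move: (M %/ r)%N Mr SM => u Mr SM.
have qM2 : ((r * c).+1 <= M * (M + 2))%N by move: qM; clear; lia.
have cq : (c <= (r * c).+1)%N by move: r1; clear; nia.
move: (r * c)%N qM2 cq SM => rc qM2 cq SM.
have E1 : (s * M <= rc.+1 * (m + (u + 2 * m + 4)))%N.
  apply: (leq_trans SM).
  have -> : (u + 2 * m + 4 = (u + 2 * m + 3).+1)%N by rewrite addnS.
  rewrite succnK mulnDr mulnS.
  have : (rc * m <= rc.+1 * m)%N by rewrite leq_mul2r leqnSn orbT.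
  by move: cq Ac; clear; move: (rc.+1 * m)%N (rc.+1 * _)%N; lia.
have E2 : (r * (s * M) <= r * (rc.+1 * (m + (u + 2 * m + 4))))%N.
  by rewrite leq_mul2l E1 orbT.
have E3 : (r * (m + (u + 2 * m + 4)) <= M + r * (3 * m + 4))%N.
  by move: Mr; clear; nia.
have E4 : (rc.+1 * (r * (m + (u + 2 * m + 4))) <= rc.+1 * (M + r * (3 * m + 4)))%N.
  by rewrite leq_mul2l E3 orbT.
have E5 : (rc.+1 * (r * (3 * m + 4)) <= M * (M + 2) * (r * (3 * m + 4)))%N.
  by rewrite leq_mul2r qM2 orbT.
have -> : (M * (r * s) = r * (s * M))%N by ring.
apply: (leq_trans E2); rewrite mulnCA; apply: (leq_trans E4).
rewrite mulnDr [X in (_ <= X)%N]mulnDr (mulnC rc.+1 M) leq_add2l.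
apply: (leq_trans E5); apply: eq_leq; ring.
Qed.

(** The relation makes [H 0] a multiple of [Z], hence zero; then one factor [Z] is cancelled and the
    argument repeats. *)
Lemma powers_independent (R : idomainType) (J : nat) (Z : R) (H : nat -> R) :
  Z != 0 -> (forall j (a : R), H j = a * Z -> H j = 0) ->
  \sum_(j < J) H j * Z ^+ j = 0 -> forall j, (j < J)%N -> H j = 0.
Proof.
move=> Z0; elim: J H => [|J IH] H HZ //.
rewrite big_ord_recl expr0 mulr1.
have -> : \sum_(i < J) H (lift ord0 i) * Z ^+ (lift ord0 i)
          = (\sum_(i < J) H i.+1 * Z ^+ i) * Z.
  by rewrite mulr_suml; apply: eq_bigr => i _; rewrite lift0 exprSr mulrA.
move=> S0; have H0 : H 0%N = 0.
  apply: (HZ 0%N (- \sum_(i < J) H i.+1 * Z ^+ i)).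
  by rewrite mulNr; apply/eqP; rewrite -addr_eq0 S0.
move/eqP: S0; rewrite H0 add0r mulf_eq0 (negPf Z0) orbF => /eqP S0.
case=> [|j] jJ //; apply: (IH (fun j => H j.+1)) => // i a; exact: HZ.
Qed.

(* The auxiliary polynomial [\sum v_ijs X^s W^(ic) (X - x0)^(jq)], with
   [i < r], [j < J] and [s < A], vanishes to order [M] at every point of [S]. *)
Lemma stepanov (K : fieldType) (r c m M : nat) (W : {poly K}) (x0 w : K) (S : seq K) :
  [pchar K].-nat (r * c).+1 -> (1 < r)%N -> no_power_relation r W ->
  (size W <= m.+1)%N -> W.[x0] != 0 -> x0 ^+ (r * c).+1 = x0 -> w != 0 ->
  uniq S -> (forall x, x \in S -> x ^+ (r * c).+1 = x /\ W.[x] ^+ c = w) ->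
  (M * M <= (r * c).+1 < M.+1 * M.+1)%N -> (4 * r * (m + 3) <= M)%N ->
  (r * size S <= (r * c).+1 + r * (3 * m + 4) * (M + 2))%N.
Proof.
move=> qK r1 nW Wm W0 x0q w0 uS SP /andP[Mq qM] Mm.
have := stepanov_arith r1 Mq Mm.
set q := (r * c).+1 in qK x0q SP Mq qM *.
pose J := (M %/ r + 2 * m + 4)%N.
have [A AE] : exists A, (c - m = A)%N by exists (c - m)%N.
have cm : (m < c)%N by nia.
rewrite -/J AE; pose D := (J + A + M * m)%N => card_lt; pose Z := ('X - x0%:P) ^+ q.
pose I : finType := ('I_r * 'I_J * 'I_A)%type.
(* Up to powers of [W], this is the l-th Hasse derivative of [X^s W^(ic)]; its degree is at most
   [s + l * m], however large [i * c] is. *)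
pose cof (i s l : nat) := \sum_(j < l.+1)
  ('X^s)^`N(j) * W ^+ j * hasse_cofactor W (i * c) (l - j).
have cofP i s l : ('X^s * W ^+ (i * c))^`N(l) * W ^+ l = W ^+ (i * c) * cof i s l.
  rewrite nderivnM mulr_suml mulr_sumr; apply: eq_bigr => -[j /= jl] _.
  have -> : W ^+ l = W ^+ (l - j) * W ^+ j by rewrite -exprD subnK.
  rewrite mulrA -(mulrA _ _ (W ^+ (l - j))) hasse_cofactorP; ring.
have cof_sz i s l : (size (cof i s l) <= (s + l * m).+1)%N.
  apply: (leq_trans (size_sum _ _ _)); apply/bigmax_leqP => -[j /= jl] _.
  have -> : (s + l * m = s + j * m + (l - j) * m)%N by rewrite -addnA -mulnDl subnKC.
  apply: size_polyM_bound (size_hasse_cofactor _ _ Wm).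
  apply: size_polyM_bound (size_polyX_bound _ Wm).
  by apply: (leq_trans (size_nderivn _ _)); rewrite size_polyXn; lia.
(* On [S] one has [W^(ic) = w^i] and [(X - x0)^q = X - x0], so there the l-th derivative is governed
   by a combination of the [Q t l]. This combination has low degree and is required to vanish
   identically. *)
pose Q (t : I) (l : nat) : {poly K} :=
  w ^+ t.1.1 *: (('X - x0%:P) ^+ t.1.2 * cof t.1.1 t.2 l).
have Qsz t l : (l < M)%N -> (size (Q t l) <= D)%N.
  move=> lM; rewrite size_scale ?expf_neq0 //.
  have sX : (size (('X - x0%:P) ^+ t.1.2) <= t.1.2.+1)%N by rewrite size_exp_XsubC.
  apply: (leq_trans (size_polyM_bound sX (cof_sz _ _ _))).
  case: t {sX} => [[i j] s] /=; rewrite /D.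
  have := ltn_ord j; have := ltn_ord s.
  have : (l * m <= M * m)%N by rewrite leq_mul2r ltnW ?orbT.
  lia.
have [v [t0 vt0] vQ] :
    exists2 v : I -> K, exists t, v t != 0 &
      forall l : 'I_M * 'I_D, \sum_t v t * (Q t l.1)`_l.2 = 0.
  by apply: underdetermined_system; rewrite !card_prod !card_ord.
have vQ0 l : (l < M)%N -> \sum_t v t *: Q t l = 0.
  move=> lM; apply/polyP => k; rewrite coef0 coef_sum.
  under eq_bigr do rewrite coefZ.
  have [kD|Dk] := ltnP k D; first exact: (vQ (Ordinal lM, Ordinal kD)).
  by rewrite big1 // => t _; rewrite nth_default ?mulr0 // (leq_trans (Qsz _ _ lM)).
pose P : {poly K} := \sum_t v t *: ('X^(t.2) * W ^+ (t.1.1 * c) * Z ^+ t.1.2).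
have Z0 : Z != 0 by rewrite expf_neq0 ?polyXsubC_eq0.
(* The value 0 for [j >= J] extends the coefficients to a sequence, as [powers_independent]
   expects. *)
pose k (j : nat) (i : 'I_r) : {poly K} :=
  if insub j is Some j' then \sum_(s < A) v (i, j', s) *: 'X^s else 0.
have ksz j i : (size (k j i) <= A.-1.+1)%N.
  rewrite /k; case: insubP => [j' _ _|_]; last by rewrite size_poly0.
  apply: (leq_trans (size_sum _ _ _)); apply/bigmax_leqP => s _.
  apply: (leq_trans (size_scale_leq _ _)); rewrite size_polyXn.
  by have := ltn_ord s; lia.
pose H j := \sum_(i < r) k j i * W ^+ (i * c).
have PH : P = \sum_(j < J) H j * Z ^+ j.
  rewrite /P; transitivity
    (\sum_(j < J) \sum_(i < r) \sum_(s < A)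
       v (i, j, s) *: ('X^s * W ^+ (i * c) * Z ^+ j)).
    rewrite exchange_big pair_bigA pair_bigA /=.
    by apply: eq_bigr => -[[i j] s].
  apply: eq_bigr => j _; rewrite mulr_suml; apply: eq_bigr => i _.
  rewrite /k valK !mulr_suml; apply: eq_bigr => s _.
  by rewrite -!scalerAl.
have P0 : P != 0.
  apply/eqP => P0; move: vt0; case: t0 => [[i0 j0] s0].
  (* As [A = c - m], the left side is [r * (c - 1)]; this condition dictates the choice of [A]. *)
  have small : (r * (A.-1 + m) < q)%N by rewrite /q; nia.
  have r0 : (0 < r)%N by lia.
  have kZ j : Z %| H j -> forall i, k j i = 0.
    by apply: (low_degree_independence qK nW erefl W0 Wm (ksz j) small r0).
  have HZ j a : H j = a * Z -> H j = 0.
    move=> Hj; rewrite /H big1 // => i _.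
    by rewrite kZ ?mul0r //; apply/dvdpP; exists a.
  have Hj0 : H j0 = 0 by apply: (powers_independent Z0 HZ _ (ltn_ord j0)); rewrite -PH.
  have := kZ j0; rewrite Hj0 dvdp0 => /(_ isT i0); rewrite /k valK.
  move=> /(congr1 (fun p : {poly K} => p`_s0)); rewrite coef0 coef_sum.
  rewrite (bigD1 s0) //= big1 ?addr0 => [|s ss].
    by rewrite coefZ coefXn eqxx mulr1 => ->; rewrite eqxx.
  by rewrite coefZ coefXn eq_sym (inj_eq val_inj) (negPf ss) mulr0.
have MleQ : (M <= q)%N by nia.
have Pdvd z : z \in S -> ('X - z%:P) ^+ M %| P.
  move=> zS; have [zq Wz] := SP z zS.
  have Wz0 : W.[z] != 0.
    apply: contraNneq w0 => Wz0; rewrite -Wz Wz0 expr0n gtn_eqF //; nia.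
  (* Modulo [(X - z)^q] the polynomial [Z] is the constant [(z - x0)^q = z - x0], so modulo
     [(X - z)^M] the powers of [Z] may be replaced by constants and only [Pz] has to be
     differentiated. *)
  pose Pz : {poly K} := \sum_t v t *: ((z - x0) ^+ t.1.2 *: ('X^(t.2) * W ^+ (t.1.1 * c))).
  have ZE : ('X - z%:P) ^+ M %| Z - (z - x0)%:P.
    apply: dvdp_trans (dvdp_exp2l _ MleQ) _.
    have := XsubC_exp_pchar ('X - x0%:P) z qK; rewrite !hornerE.
    have -> // : (z - x0) ^+ q = z - x0.
    have := exprDn_pchar (z - x0) x0 qK; rewrite subrK zq x0q => zE.
    by apply: (addIr x0); rewrite -zE subrK.
  have -> : P = (P - Pz) + Pz by rewrite subrK.
  apply: dvdp_add; last first.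
    apply: XsubC_exp_dvdP => l lM.
    apply: (mulIf (expf_neq0 l Wz0)); rewrite mul0r -horner_exp -hornerM.
    have -> : Pz^`N(l) * W ^+ l =
        \sum_t v t *: ((z - x0) ^+ t.1.2 *: (W ^+ (t.1.1 * c) * cof t.1.1 t.2 l)).
      rewrite linear_sum mulr_suml; apply: eq_bigr => t _ /=.
      by rewrite !nderivnZ -!scalerAl cofP.
    have := congr1 (horner^~ z) (vQ0 l lM); rewrite horner0 !horner_sum => {2}<-.
    apply: eq_bigr => t _; rewrite /Q !hornerZ !hornerM !horner_exp !hornerXsubC.
    by rewrite mulnC exprM Wz; ring.
  rewrite /P /Pz -sumrB.
  apply: (big_ind (fun Q => ('X - z%:P) ^+ M %| Q)) => [|a b|t _].
  - exact: dvdp0.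
  - exact: dvdp_add.
  - set B := _ * W ^+ _.
    have -> : v t *: (B * Z ^+ t.1.2) - v t *: ((z - x0) ^+ t.1.2 *: B)
              = (v t)%:P * B * (Z ^+ t.1.2 - (z - x0)%:P ^+ t.1.2).
      by rewrite -!mul_polyC polyC_exp; ring.
    by apply: dvdp_mull; rewrite subrXX; apply: dvdp_mulr.
have Psz : (size P <= (A.-1 + (r * c) * m + q * J.-1).+1)%N.
  apply: (leq_trans (size_sum _ _ _)); apply/bigmax_leqP => -[[i j] s] _ /=.
  apply: (leq_trans (size_scale_leq _ _)).
  have := ltn_ord i; have := ltn_ord j; have := ltn_ord s => sA jJ ir.
  have E1 : (size ('X^s * W ^+ (i * c))%R <= (A.-1 + (r * c) * m).+1)%N.
    have sX : (size ('X^s : {poly K})%R <= A.-1.+1)%N by rewrite size_polyXn; lia.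
    apply: (leq_trans (size_polyM_bound sX (size_polyX_bound _ Wm))).
    by rewrite ltnS leq_add2l leq_mul2r leq_mul2r (ltnW ir) !orbT.
  have E2 : (size (Z ^+ j)%R <= (q * J.-1).+1)%N.
    by rewrite -exprM size_exp_XsubC ltnS leq_mul2l; apply/orP; right; lia.
  exact: size_polyM_bound E1 E2.
have prodP : \prod_(z <- S) ('X - z%:P) ^+ M %| P.
  elim: S uS Pdvd {SP} => [|z S IH] /=; first by rewrite big_nil dvd1p.
  move=> /andP[zS uS] Pdvd; rewrite big_cons Gauss_dvdp.
    rewrite Pdvd ?mem_head //=; apply: IH => // y yS.
    by apply: Pdvd; rewrite inE yS orbT.
  rewrite big_seq; apply: (big_ind (fun Q => coprimep _ Q)) => [|a b Ca Cb|y yS].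
  - exact: coprimep1.
  - by rewrite coprimepMr Ca.
  - apply/coprimep_expl/coprimep_expr; rewrite coprimep_XsubC root_XsubC.
    by apply/eqP => yz; move: zS; rewrite -yz yS.
have := leq_trans (dvdp_leq P0 prodP) Psz.
have -> : size (\prod_(z <- S) ('X - z%:P) ^+ M) = (size S * M).+1.
  have p0 : \prod_(z <- S) ('X - z%:P) != 0 by rewrite monic_neq0 ?monic_prod_XsubC.
  by rewrite prodrXl -[LHS]prednK ?size_poly_gt0 ?expf_neq0 // size_exp size_prod_XsubC.
rewrite ltnS => SM.
have Ac : (A <= c)%N by rewrite -AE leq_subr.
exact: stepanov_arith_final r1 Ac Mq qM Mm SM.
Qed.

(** * Multiplicities and value distribution of power residues *)

Lemma mupX (K : fieldType) (x : K) (p : {poly K}) (n : nat) :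
  p != 0 -> mup x (p ^+ n) = (n * mup x p)%N.
Proof.
move=> p0; elim: n => [|n IH]; first by rewrite expr0 mupNroot ?root1.
by rewrite exprS mupM ?expf_neq0 // IH mulSn.
Qed.

Lemma mupZ (K : fieldType) (x a : K) (p : {poly K}) :
  a != 0 -> mup x (a *: p) = mup x p.
Proof. by move=> a0; rewrite -mul_polyC mupMr // rootC. Qed.

Lemma dvdn_mul_biggcd (I : Type) (d b e : nat) (s : seq I) (f : I -> nat) :
  (d %| b * e)%N -> all (fun i => d %| b * f i)%N s ->
  (d %| b * \big[gcdn/e]_(i <- s) f i)%N.
Proof.
move=> de; elim: s => [|i s IH] /=; first by rewrite big_nil.
by move=> /andP[di ds]; rewrite big_cons muln_gcdr dvdn_gcd di IH.
Qed.

Lemma biggcd_dvd (I : eqType) (e : nat) (s : seq I) (f : I -> nat) (i : I) :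
  i \in s -> (\big[gcdn/e]_(j <- s) f j %| f i)%N.
Proof.
elim: s => [|j s IH] //; rewrite inE big_cons => /orP[/eqP->|/IH d].
  exact: dvdn_gcdl.
exact: dvdn_trans (dvdn_gcdr _ _) d.
Qed.

Lemma biggcd_dvd_idx (I : Type) (e : nat) (s : seq I) (f : I -> nat) :
  (\big[gcdn/e]_(j <- s) f j %| e)%N.
Proof.
elim: s => [|j s IH]; first by rewrite big_nil.
by rewrite big_cons (dvdn_trans (dvdn_gcdr _ _)).
Qed.

(** The cofactor of [A - B] in [A^t - B^t] is a sum of [t] monic polynomials of equal degree, so its
    leading coefficient is [t], which is nonzero. *)
Lemma monic_expr_inj (K : fieldType) (A B : {poly K}) (t : nat) :
  A \is monic -> B \is monic -> t%:R != 0 :> K -> A ^+ t = B ^+ t -> A = B.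
Proof.
move=> Am Bm t0 AB; apply/eqP; rewrite -subr_eq0.
have := subrXX A B t; rewrite AB subrr => /esym/eqP; rewrite mulf_eq0 => /orP[//|].
have t_gt0 : (0 < t)%N by case: (t) t0 => //; rewrite eqxx.
have sAB : size A = size B.
  have := congr1 (fun p : {poly K} => (size p).-1) AB; rewrite /= !size_exp.
  have := size_poly_gt0 A; have := size_poly_gt0 B; rewrite !monic_neq0 //.
  move: (size A) (size B) => a b; nia.
pose n := (size B).-1.
suff E : (\sum_(i < t) A ^+ (t.-1 - i) * B ^+ i)`_(n * t.-1) = t%:R.
  by move=> /eqP S0; move: E t0; rewrite S0 coef0 => <-; rewrite eqxx.
rewrite coef_sum (eq_bigr (fun=> 1)) => [|[i /= it] _].
  by rewrite sumr_const card_ord.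
have m : A ^+ (t.-1 - i) * B ^+ i \is monic by rewrite rpredM ?rpredX.
have /monicP := m; rewrite lead_coefE => <-; congr (_`_ _).
rewrite size_proper_mul; last first.
  by rewrite !lead_coef_exp (monicP Am) (monicP Bm) !expr1n mulr1 oner_neq0.
have sX (p : {poly K}) k : p \is monic -> size (p ^+ k) = (k * (size p).-1).+1 :> nat.
  move=> pm; rewrite -[LHS]prednK ?size_poly_gt0 ?monic_neq0 ?rpredX //.
  by rewrite size_exp mulnC.
rewrite !sX // sAB /n; move: (size B).-1 => s.
rewrite addSn addnS /=; nia.
Qed.

(* [G^phi = l W^t] with [t] maximal among the divisors of [e], and [r = e / t]:
   the values [G(x)^c] lie in a coset of the [r]-th roots of unity, and Stepanov's
   method applied to [W] bounds how often each of them is taken. *)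
Lemma power_residue_distribution (F : finFieldType) (K : closedFieldType)
    (phi : {rmorphism F -> K}) (e c m M : nat) (G : {poly F}) (alpha : K) :
  #|F| = (e * c).+1 -> [pchar K].-nat #|F| -> G != 0 -> (size G <= m.+1)%N ->
  ~~ (e %| mup alpha (map_poly phi G))%N ->
  (M * M <= #|F| < M.+1 * M.+1)%N -> (4 * e * (m + 3) <= M)%N ->
  exists r (k : F), [/\ (1 < r)%N, (r %| e)%N,
    forall x, G.[x] != 0 -> (G.[x] ^+ c) ^+ r = k &
    forall w, w != 0 ->
      (r * #|[set x | G.[x] ^+ c == w]%SET|
        <= #|F| + r * (3 * m + 4) * (M + 2))%N].
Proof.
move=> Fe qK G0 Gm aG Mq Mm.
set Gp := map_poly phi G in aG.
have Gp0 : Gp != 0 by rewrite map_poly_eq0.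
have [rs GE] := closed_field_poly_normal Gp.
set l := lead_coef Gp in GE; have l0 : l != 0 by rewrite lead_coef_eq0.
have mupG z : mup z Gp = count_mem z rs by rewrite GE mupZ // mu_prod_XsubC.
pose t := \big[gcdn/e]_(z <- rs) count_mem z rs.
have te : (t %| e)%N by apply: biggcd_dvd_idx.
have tz z : (t %| count_mem z rs)%N.
  have [zr|zr] := boolP (z \in rs); first exact: (biggcd_dvd _ (fun z => count_mem z rs)).
  by rewrite (count_memPn zr) dvdn0.
have e0 : (0 < e)%N.
  by rewrite lt0n; apply/eqP => e0; have := finNzRing_gt1 F; rewrite Fe e0.
have t0 : (0 < t)%N by rewrite (dvdn_gt0 e0).
pose r := (e %/ t)%N; have rt : (r * t = e)%N by rewrite divnK.
pose W : {poly K} := \prod_(z <- undup rs) ('X - z%:P) ^+ (count_mem z rs %/ t).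
have WtE : W ^+ t = \prod_(z <- rs) ('X - z%:P).
  rewrite -[RHS]prodr_undup_exp_count -prodrXl; apply: eq_bigr => z _.
  by rewrite -exprM divnK.
have Wm : W \is monic by apply: monic_prod => z _; rewrite monic_exp ?monicXsubC.
have W0 : W != 0 by exact: monic_neq0.
have GW : Gp = l *: W ^+ t by rewrite WtE.
have mupW z : (t * mup z W)%N = count_mem z rs by rewrite -mupX // WtE mu_prod_XsubC.
have r_gt1 : (1 < r)%N.
  have r_gt0 : (0 < r)%N by rewrite divn_gt0 // dvdn_leq.
  rewrite ltn_neqAle r_gt0 andbT; apply: contra aG => /eqP r1.
  by rewrite mupG -rt -r1 mul1n.
have re : (r %| e)%N by rewrite -rt dvdn_mulr.
(* Multiplicities in such a relation give [r %| b * mup z W], that is, [e] divides [b] times each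
   multiplicity of [G]. As [t] is the gcd of these and [e], it follows that [e %| b * t], so
   [r %| b]. *)
have noW : no_power_relation r W.
  move=> b A B k /andP[b0 br] k0 A0 B0 AB.
  have rb z : (r %| b * mup z W)%N.
    have := congr1 (mup z) AB; rewrite mupM ?expf_neq0 // mupZ // !mupX // => E.
    by rewrite -(dvdn_addr _ (dvdn_mulr (mup z A) (dvdnn r))) E dvdn_mulr.
  have : (e %| b * t)%N.
    apply: dvdn_mul_biggcd; first exact: dvdn_mull.
    apply/allP => z _; rewrite -mupW -rt mulnCA mulnC dvdn_pmul2l //.
  by rewrite -rt dvdn_pmul2r // => /(dvdn_leq b0); rewrite leqNgt br.
pose c' := (t * c)%N; have rc : #|F| = (r * c').+1 by rewrite Fe -rt mulnA.
have phiq x : phi x ^+ #|F| = phi x by rewrite -rmorphXn /= expf_card.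
have q0 : #|F|%:R = 0 :> K.
  have q1 : (1 < #|F|)%N by exact: finNzRing_gt1.
  have pK : pdiv #|F| \in [pchar K] by rewrite (pnatPpi qK) ?pi_pdiv.
  have /dvdnP[u ->] := pdiv_dvd #|F|.
  by rewrite natrM (pcharf0 pK) mulr0.
have tK : t%:R != 0 :> K.
  apply/eqP => tK; move/eqP: q0; rewrite Fe -rt -addn1 natrD !natrM tK.
  by rewrite mulr0 mul0r add0r oner_eq0.
(* The Frobenius map fixes [Gp], hence [W^t], hence [W] by uniqueness of monic t-th roots. Thus
   [W(x)^q = W(x)] at points [x] of [F]. *)
pose frob (x : K) := x ^+ #|F|.
have frobD : GRing.nmod_morphism frob.
  split=> [|x y]; first by rewrite /frob expr0n gtn_eqF // ltnW ?finNzRing_gt1.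
  exact: exprDn_pchar.
have frobM : GRing.monoid_morphism frob.
  by split=> [|x y]; rewrite /frob ?expr1n ?exprMn.
pose frobR : {rmorphism K -> K} := HB.pack frob
  (GRing.isNmodMorphism.Build _ _ frob frobD)
  (GRing.isMonoidMorphism.Build _ _ frob frobM).
have frobG : map_poly frobR Gp = Gp.
  apply/polyP => i; rewrite !coef_map; exact: phiq.
have frobW : map_poly frobR W = W.
  apply: (monic_expr_inj _ Wm tK); first by rewrite monic_map.
  have lq : frobR l = l by rewrite /l lead_coef_map; exact: phiq.
  have := frobG; rewrite GW map_polyZ lq rmorphXn /=.
  exact: scalerI.
have Wq x : W.[phi x] ^+ (r * c') = 1 \/ W.[phi x] = 0.
  have [->|Wx] := eqVneq W.[phi x] 0; [by right | left].
  apply: (mulfI Wx); rewrite -exprS -rc mulr1.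
  rewrite -[LHS]/(frobR _) -horner_map frobW; congr _.[_]; exact: phiq.
have hornG x : phi G.[x] = l * W.[phi x] ^+ t.
  by rewrite -horner_map -/Gp GW hornerZ horner_exp.
have hornGc x : phi (G.[x] ^+ c) = l ^+ c * W.[phi x] ^+ c'.
  by rewrite rmorphXn /= hornG exprMn exprM.
(* Where [G] does not vanish, [G^(cr) = l^(cr) W^(q-1) = l^(cr)]. *)
exists r, (lead_coef G ^+ (c * r)); split=> // [x Gx|w w0].
  apply: (fmorph_inj phi); rewrite rmorphXn /= hornGc exprMn -!exprM (mulnC c' r).
  case: (Wq x) => [->|Wx].
    by rewrite mulr1 rmorphXn /= /l lead_coef_map.
  move: Gx; rewrite -(fmorph_eq0 phi) hornG Wx expr0n gtn_eqF //.
  by rewrite mulr0 eqxx.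
have [x0 Gx0] : exists x0, G.[x0] != 0.
  apply/existsP; apply: contraT; rewrite negb_exists => /forallP H.
  have := max_poly_roots G0 (_ : all (root G) (enum F)) (enum_uniq _).
  rewrite -cardE => /(_ _)/wrap[].
    by apply/allP => x _; have := H x; rewrite negbK.
  move=> qG; have : (size G <= #|F|)%N.
    rewrite (leq_trans Gm) //; case/andP: Mq => Mq _; move: Mq Mm e0.
    by move: (#|F|) => q'; clear; nia.
  by move=> /(leq_trans qG); rewrite ltnn.
rewrite rc.
have Wx0 : W.[phi x0] != 0.
  move: Gx0; rewrite -(fmorph_eq0 phi) hornG mulf_eq0 negb_or => /andP[_].
  by rewrite expf_eq0 t0.
have x0q : phi x0 ^+ (r * c').+1 = phi x0 by rewrite -rc.
pose S := [seq phi x | x <- enum [set x | G.[x] ^+ c == w]%SET].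
have -> : #|[set x | G.[x] ^+ c == w]%SET| = size S by rewrite size_map -cardE.
apply: (@stepanov K r c' m M W (phi x0) (phi w / l ^+ c) S) => //.
- by rewrite -rc.
- apply: leq_trans Gm; rewrite -(size_map_poly phi) -/Gp; apply: dvdp_leq => //.
  by rewrite GW dvdpZr // -(prednK t0) exprS dvdp_mulr.
- by rewrite mulf_neq0 ?invr_eq0 ?expf_neq0 ?fmorph_eq0.
- by rewrite map_inj_uniq ?enum_uniq //; exact: fmorph_inj.
- move=> z /mapP[x]; rewrite mem_enum inE => /eqP <- ->; rewrite -rc phiq.
  by split=> //; rewrite hornGc mulrC mulKf ?expf_neq0.
- by rewrite -rc.
- by apply: leq_trans Mm; rewrite leq_mul2r leq_mul2l dvdn_leq ?orbT.
Qed.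

(** * Character sums *)

Lemma norm_unity_root (C : numClosedFieldType) (n : nat) (z : C) :
  (0 < n)%N -> z ^+ n = 1 -> `|z| = 1.
Proof.
move=> n0 zn; apply/eqP; rewrite -(pexpr_eq1 n0) ?normr_ge0 //.
by rewrite -normrX zn normr1.
Qed.

Lemma sum_unity_powers (R : idomainType) (n : nat) (z : R) :
  z ^+ n = 1 -> z != 1 -> \sum_(i < n) z ^+ i = 0.
Proof.
move=> zn z1; apply/eqP; rewrite -(inj_eq (mulfI (_ : z - 1 != 0))).
  by rewrite -subrX1 zn subrr mulr0.
by rewrite subr_eq0.
Qed.

Section RootCharacter.

Variables (F : fieldType) (C : numClosedFieldType) (e : nat) (w : F) (z : C).
Hypotheses (wP : e.-primitive_root w) (zP : e.-primitive_root z).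

(** The character of the group generated by [w] that sends [w] to [z], extended by 0. Composed with
    [y -> y^c], it becomes a multiplicative character of order [e] of the finite field. *)
Definition root_char (y : F) : C :=
  if [pick i : 'I_e | w ^+ i == y] is Some i then z ^+ i else 0.

Lemma root_charX n : root_char (w ^+ n) = z ^+ n.
Proof.
rewrite /root_char; case: pickP => [i /eqP E|/(_ (Ordinal (ltn_pmod n _)))].
  by apply/eqP; rewrite (eq_prim_root_expr zP) -(eq_prim_root_expr wP) E.
move=> /(_ (prim_order_gt0 wP))/eqP[]; by rewrite /= prim_expr_mod.
Qed.

Lemma root_char_repr y : y ^+ e = 1 -> exists2 n, y = w ^+ n & root_char y = z ^+ n.
Proof.
by move=> /(prim_rootP wP)[i ->]; exists i => //; rewrite root_charX.
Qed.

Lemma norm_root_power n : `|z ^+ n| = 1.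
Proof.
by rewrite normrX (norm_unity_root (prim_order_gt0 zP)) ?expr1n ?prim_expr_order.
Qed.

(** The values of [h] lie in a coset of the r-th roots of unity, over which the character sums to 0.
    Hence [B] may be subtracted from each [r * N j] without changing the sum; all differences are
    then nonpositive and their absolute values add up to [r * (B - #|X|)]. So upper bounds on the
    frequencies suffice. *)
Lemma root_char_sum_bound (T : finType) (X : {set T}) (h : T -> F) (r B : nat) (k : F) :
  (forall x, x \in X -> h x ^+ e = 1) -> (1 < r)%N -> (r %| e)%N ->
  (forall x, x \in X -> h x ^+ r = k) ->
  (forall y, y != 0 -> (r * #|[set x in X | h x == y]| <= B)%N) ->
  `|\sum_(x in X) root_char (h x)| <= (B%:R - #|X|%:R : C).
Proof.
move=> he r1 re hr hB; have r0 : (0 < r)%N by lia.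
have [X0|[x1 x1X]] := set_0Vmem X.
  by rewrite X0 big_set0 normr0 cards0 subr0 ler0n.
pose d := (e %/ r)%N; have de : (d * r)%N = e by rewrite divnK.
have [n1 h1 ch1] := root_char_repr (he _ x1X).
have d_prim (L : fieldType) (y : L) : e.-primitive_root y -> r.-primitive_root (y ^+ d).
  by move=> yP; have := dvdn_prim_root yP re.
pose y j := w ^+ (n1 + d * j).
have y0 j : y j != 0.
  rewrite expf_neq0 //; apply/eqP => w0; have := prim_expr_order wP.
  by rewrite w0 expr0n gtn_eqF ?(prim_order_gt0 wP) // => /esym/eqP; rewrite oner_eq0.
have y_inj : injective (fun j : 'I_r => y j).
  move=> i j /eqP; rewrite /y !exprD -subr_eq0 -mulrBr mulf_eq0.
  have := y0 0%N; rewrite /y muln0 addn0 => /negPf-> /=; rewrite subr_eq0 !exprM.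
  by rewrite (eq_prim_root_expr (d_prim _ _ wP)) !modn_small // => /eqP/val_inj.
have hy x : x \in X -> exists j : 'I_r, h x = y j.
  move=> xX; have h10 : h x1 != 0.
    by have := y0 0%N; rewrite /y muln0 addn0 h1.
  have : (h x / h x1) ^+ r = 1 by rewrite expr_div_n !hr // divff // -(hr _ x1X) expf_neq0.
  move=> /(prim_rootP (d_prim _ _ wP))[j hj]; exists j.
  by rewrite /y exprD exprM -hj -h1 mulrC divfK.
pose N j := #|[set x in X | h x == y j]|.
have sumX (f : F -> C) : \sum_(x in X) f (h x) = \sum_(j < r) (N j)%:R * f (y j).
  rewrite (eq_bigr (fun x => \sum_(j < r | h x == y j) f (y j))) => [|x xX].
    rewrite (exchange_big_dep predT) //=; apply: eq_bigr => j _.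
    by rewrite sumr_const mulr_natl; congr (_ *+ _); apply: eq_card => x; rewrite !inE.
  have [j hj] := hy x xX; rewrite hj (big_pred1 j) // => i /=.
  by rewrite eq_sym (inj_eq y_inj).
have Xcard : #|X|%:R = \sum_(j < r) (N j)%:R :> C.
  have := sumX (fun=> 1); rewrite sumr_const => ->.
  by apply: eq_bigr => j _; rewrite mulr1.
have zr : r.-primitive_root (z ^+ d) by exact: (dvdn_prim_root zP re).
have S0 : \sum_(j < r) z ^+ (n1 + d * j) = 0.
  under eq_bigr do rewrite exprD exprM.
  rewrite -mulr_sumr (sum_unity_powers (prim_expr_order zr)) ?mulr0 //.
  apply/eqP => z1; have := eq_prim_root_expr zr 1 0.
  by rewrite expr1 expr0 z1 eqxx mod0n modn_small.
have rE : r%:R * \sum_(x in X) root_char (h x)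
          = \sum_(j < r) ((r * N j)%:R - B%:R) * z ^+ (n1 + d * j).
  under [RHS]eq_bigr do rewrite mulrBl.
  rewrite sumrB -mulr_sumr S0 mulr0 subr0 sumX mulr_sumr.
  by apply: eq_bigr => j _; rewrite root_charX natrM mulrA.
rewrite -(ler_pM2l (_ : 0 < r%:R)) ?ltr0n //.
rewrite -[X in X * `|_|]ger0_norm ?ler0n // -normrM rE.
apply: (le_trans (ler_norm_sum _ _ _)).
rewrite Xcard mulrBr mulr_sumr.
have -> : r%:R * B%:R = \sum_(j < r) (B%:R : C).
  by rewrite sumr_const card_ord mulr_natl.
rewrite -sumrB; apply: ler_sum => j _.
rewrite normrM norm_root_power mulr1 distrC -natrM ger0_norm //.
by rewrite subr_ge0 ler_nat hB.
Qed.

(** With [a t x = root_char (y t x) / z ^+ u t], the product over [t] of the sums of [a t x ^+ k],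
    [k < e], vanishes unless [x] realises the pattern. If no [x] does, expanding and summing over
    [X] gives 0, although the trivial exponent contributes [#|X|] and each of the others at most
    [D]. *)
Lemma pattern_exists (I T : finType) (X : {set T}) (y : I -> T -> F) (D : nat)
    (u : I -> nat) :
  (forall x t, x \in X -> y t x ^+ e = 1) ->
  (forall v : {ffun I -> 'I_e}, (exists t, v t != 0 :> nat) ->
    `|\sum_(x in X) root_char (\prod_t y t x ^+ v t)| <= D%:R) ->
  (e ^ #|I| * D < #|X|)%N ->
  exists2 x, x \in X & forall t, y t x = w ^+ u t.
Proof.
move=> ye yD XD; have e0 := prim_order_gt0 wP.
have [/exists_inP[x xX /forallP H]|] := boolP [exists x in X, [forall t, y t x == w ^+ u t]].
  by exists x => // t; apply/eqP.
rewrite negb_exists_in => /forall_inP H; exfalso; move: XD; apply/negP; rewrite -leqNgt.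
pose a t x := root_char (y t x) / z ^+ u t.
have z0 n : z ^+ n != 0 by rewrite -normr_eq0 norm_root_power oner_eq0.
have sum_a x : x \in X -> \prod_t (\sum_(k < e) a t x ^+ k) = 0.
  move=> xX; have := H x xX; rewrite negb_forall => /existsP[t yt].
  rewrite (bigD1 t) //= sum_unity_powers ?mul0r //.
    have [n yn cn] := root_char_repr (ye _ t xX).
    by rewrite /a cn expr_div_n -!exprM ![(_ * e)%N]mulnC !exprM (prim_expr_order zP) !expr1n divr1.
  have [n yn cn] := root_char_repr (ye _ t xX).
  apply: contra yt => /eqP az; rewrite yn (eq_prim_root_expr wP) -(eq_prim_root_expr zP).
  by rewrite -(inj_eq (mulIf (_ : (z ^+ u t)^-1 != 0))) ?invr_eq0 // divff // -cn; apply/eqP.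
pose v0 : {ffun I -> 'I_e} := [ffun=> Ordinal e0].
have chM x (v : {ffun I -> 'I_e}) : x \in X ->
    root_char (\prod_t y t x ^+ v t) = \prod_t root_char (y t x) ^+ v t.
  move=> xX; have yn t := root_char_repr (ye _ t xX).
  have [n nP] : exists n : I -> nat, forall t, y t x = w ^+ n t /\ root_char (y t x) = z ^+ n t.
    have nE t : exists i : 'I_e, y t x == w ^+ i.
      by have /(prim_rootP wP)[i ->] := ye _ t xX; exists i.
    exists (fun t => (xchoose (nE t) : nat)) => t; have /eqP E := xchooseP (nE t).
    by split=> //; rewrite {1}E root_charX.
  rewrite (eq_bigr (fun t => w ^+ (n t * v t))) => [|t _]; last by rewrite (nP t).1 exprM.
  rewrite -expr_sum root_charX expr_sum.
  by apply: eq_bigr => t _; rewrite (nP t).2 exprM.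
have expand : \sum_(v : {ffun I -> 'I_e}) \sum_(x in X) \prod_t a t x ^+ v t = 0.
  rewrite exchange_big /= big1 // => x xX.
  by have := sum_a x xX; rewrite bigA_distr_bigA.
have bound (v : {ffun I -> 'I_e}) : v != v0 -> `|\sum_(x in X) \prod_t a t x ^+ v t| <= D%:R.
  move=> vv0; have [t vt] : exists t, v t != 0 :> nat.
    apply/existsP; apply: contraT; rewrite negb_exists => /forallP v0'.
    case/eqP: vv0; apply/ffunP => t; rewrite ffunE; apply: val_inj => /=.
    by apply/eqP; have := v0' t; rewrite negbK.
  have -> : \sum_(x in X) \prod_t a t x ^+ v t =
      (\prod_t z ^+ (u t * v t))^-1 * \sum_(x in X) root_char (\prod_t y t x ^+ v t).
    rewrite mulr_sumr; apply: eq_bigr => x xX; rewrite chM // -prodfV -big_split /=.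
    by apply: eq_bigr => s _; rewrite /a expr_div_n exprM mulrC.
  rewrite normrM normfV -expr_sum norm_root_power invr1 mul1r.
  by apply: yD; exists t.
have v0X : \sum_(x in X) \prod_t a t x ^+ v0 t = #|X|%:R.
  rewrite -sumr_const; apply: eq_bigr => x _.
  by rewrite big1 // => t _; rewrite ffunE expr0.
move/eqP: expand; rewrite (bigD1 v0) //= v0X addr_eq0 => /eqP XE.
rewrite -(ler_nat C) -[X in X <= _]ger0_norm ?ler0n // XE normrN.
apply: (le_trans (ler_norm_sum _ _ _)); apply: (le_trans (ler_sum _ _)) => [v|].
  exact: bound.
rewrite sumr_const -mulrnA ler_nat mulnC leq_mul2r; apply/orP; right.
by rewrite (leq_trans (max_card _)) // card_ffun card_ord.
Qed.

End RootCharacter.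

Lemma card_roots_leq (F : finFieldType) (p : {poly F}) (n : nat) :
  p != 0 -> (size p <= n.+1)%N -> (#|[set x | root p x]%SET| <= n)%N.
Proof.
move=> p0 pn; rewrite cardE -ltnS; apply: leq_trans pn.
apply: max_poly_roots => //; last exact: enum_uniq.
by apply/allP => x; rewrite mem_enum inE.
Qed.

Lemma finField_prim_root (F : finFieldType) (e c : nat) :
  #|F| = (e * c).+1 -> exists w : F, e.-primitive_root w.
Proof.
move=> Fe; have q1 : (0 < e * c)%N by have := finNzRing_gt1 F; rewrite Fe.
pose rs := enum [set x : F | x != 0]%SET.
have rs1 : all (e * c).-unity_root rs.
  apply/allP => x; rewrite mem_enum inE => x0; apply/unity_rootP.
  by apply: (mulfI x0); rewrite -exprS -Fe expf_card mulr1.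
have rsq : (e * c <= size rs)%N.
  by rewrite -cardE cardsE (cardC1 (0 : F)) Fe.
have /hasP[w _ wP] := has_prim_root q1 rs1 (enum_uniq _) rsq.
exists (w ^+ c); move: q1; rewrite muln_gt0 => /andP[e0 c0].
by have := dvdn_prim_root wP (dvdn_mulr c (dvdnn e)); rewrite mulKn.
Qed.

(** Discarding the at most [n] zeros of [Z] leaves points where all [g t] are nonzero, so that their
    c-th powers are e-th roots of unity. This loss is the summand [n] in the error term. *)
Lemma residue_pattern_exists (F : finFieldType) (K : closedFieldType)
    (phi : {rmorphism F -> K}) (I : finType) (e c m n M : nat)
    (g : I -> {poly F}) (Z : {poly F}) (w : F) (u : I -> nat) :
  #|F| = (e * c).+1 -> [pchar K].-nat #|F| -> e.-primitive_root w ->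
  (forall t, g t %| Z) -> Z != 0 -> (size Z <= n.+1)%N ->
  (forall v : I -> 'I_e, (size (\prod_t g t ^+ v t)%R <= m.+1)%N) ->
  (forall v : I -> 'I_e, (exists t, v t != 0 :> nat) ->
    exists alpha, ~~ (e %| mup alpha (map_poly phi (\prod_t g t ^+ v t)))%N) ->
  (M * M <= #|F| < M.+1 * M.+1)%N -> (4 * e * (m + 3) <= M)%N ->
  (e ^ #|I| * (e * (3 * m + 4) * (M + 2) + n) + n < #|F|)%N ->
  exists2 x, Z.[x] != 0 & forall t, (g t).[x] ^+ c = w ^+ u t.
Proof.
move=> Fe qK wP gZ Z0 Zn gm gnd Mq Mm bound.
have e0 : (0 < e)%N := prim_order_gt0 wP.
have [z zP] := C_prim_root_exists e0.
pose X := [set x | Z.[x] != 0]%SET.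
have Xcard : (#|F| <= #|X| + n)%N.
  rewrite -(cardsC X) leq_add2l; apply: leq_trans (card_roots_leq Z0 Zn).
  by apply: subset_leq_card; apply/fintype.subsetP => x; rewrite !inE negbK rootE.
have g0 t x : x \in X -> (g t).[x] != 0.
  rewrite inE; apply: contraNneq => gx; have /dvdpP[p ->] := gZ t.
  by rewrite hornerM gx mulr0.
pose y t x := (g t).[x] ^+ c.
have y1 (x : F) : x != 0 -> (x ^+ c) ^+ e = 1.
  by move=> x0; apply: (mulfI x0); rewrite -exprM mulnC -exprS -Fe expf_card mulr1.
have ye x t : x \in X -> y t x ^+ e = 1 by move=> xX; rewrite y1 ?g0.
have [||x] := @pattern_exists F _ e w z wP zP I F X y
  (e * (3 * m + 4) * (M + 2) + n) u ye.
- move=> v v0; pose G := \prod_t g t ^+ v t.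
  have GX x : x \in X -> G.[x] != 0.
    by move=> xX; rewrite horner_prod; apply/prodf_neq0 => t _; rewrite horner_exp expf_neq0 ?g0.
  have G0 : G != 0.
    have : (0 < #|X|)%N by lia.
    move=> /card_gt0P[x /GX]; apply: contraNneq => ->; by rewrite horner0.
  have [alpha aG] := gnd v v0.
  have [r [k [r1 re rk rB]]] := power_residue_distribution Fe qK G0 (gm v) aG Mq Mm.
  rewrite (eq_bigr (fun x => root_char e w z (G.[x] ^+ c))) => [|x xX]; last first.
    rewrite /G horner_prod -prodrXl; congr root_char.
    by apply: eq_bigr => t _; rewrite horner_exp -!exprM mulnC.
  apply: le_trans (root_char_sum_bound wP zP (B := #|F| + e * (3 * m + 4) * (M + 2))
    _ r1 re (k := k) _ _) _ => [x xX|x xX|w' w'0|].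
  + by rewrite y1 ?GX.
  + by rewrite rk ?GX.
  + apply: leq_trans (leq_trans (rB w' w'0) _).
      rewrite leq_mul2l; apply/orP; right; apply: subset_leq_card.
      by apply/fintype.subsetP => x; rewrite !inE => /andP[].
    by rewrite leq_add2l !leq_mul2r dvdn_leq ?orbT.
  + rewrite lerBlDr -natrD ler_nat; lia.
- lia.
- by move=> xX xu; exists x => //; move: xX; rewrite inE.
Qed.

(** * The critical orbit *)

Lemma poly_dvd_eq0 (K : fieldType) (p q : {poly K}) (n : nat) :
  (n < size p)%N -> (size q <= n)%N -> p %| q -> q = 0.
Proof.
move=> np qn pq; apply/eqP; apply: contraT => q0.
by have := leq_trans (dvdp_leq q0 pq) qn; rewrite leqNgt np.
Qed.

Ltac size_lia :=
  repeat match goal with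
    | H : is_true (leq _ _) |- _ => revert H
    | H : @eq nat _ _ |- _ => revert H end;
  clear;
  repeat match goal with |- context [@size ?T ?p] => generalize (@size T p) end;
  intros; lia.

(* Differentiation yields [A V + X = U T] with [V = 4X A' - A], hence
   [(A V + X)^2 S = U^2 ((A^2 + X)^2 + 2X)]. As [S] and [U] have small degree, [V] is
   [A] times a small factor too, and the identity can be compared coefficientwise
   as a polynomial in [A]. *)
Lemma no_square_cofactor (K : fieldType) (A S T : {poly K}) (N s : nat) :
  2%:R != 0 :> K -> size A = N.+1 -> (size S <= s.+1)%N -> (s + 2 < N)%N ->
  T.[0] != 0 -> (A ^+ 2 + 'X) ^+ 2 + 2%:R * 'X = S * T ^+ 2 -> False.
Proof.
move=> two0 sA sS sN T0 E; set x : {poly K} := 'X in E *.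
have x0 : x != 0 by rewrite polyX_eq0.
have sx : size x = 2%N by rewrite size_polyX.
have A0 : A != 0 by rewrite -size_poly_eq0 sA.
have two0' : 2%:R != 0 :> {poly K} by rewrite -polyC_natr polyC_eq0.
pose F := A ^+ 2 + x; pose V := 4%:R * x * A^`() - A; pose R := A * V + x.
have sF : size F = (2 * N).+1.
  have sA2 : size (A ^+ 2) = (2 * N).+1.
    by rewrite expr2 size_mul // sA; size_lia.
  by rewrite size_polyDl // sA2 sx; size_lia.
have F0 : F != 0 by rewrite -size_poly_eq0 sF.
have ET : T %| F * F + 2%:R * x.
  by rewrite -expr2 E dvdp_mull // dvdp_mulr.
(* A common divisor divides [2X], whereas [T] does not vanish at 0. *)
have TF : coprimep T F.
  apply/coprimepP => D DT DF.
  have Dx : D %| x.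
    have : D %| 2%:R * x by rewrite -(dvdp_addr _ (dvdp_mulr F DF)) (dvdp_trans DT).
    by rewrite -polyC_natr mul_polyC dvdpZr.
  have : coprimep T x by rewrite coprimepX rootE.
  by move/coprimepP; apply.
have derA : (A ^+ 2)^`() = 2%:R * A * A^`() by rewrite expr2 derivM; ring.
have derF : F^`() = 2%:R * A * A^`() + 1 by rewrite /F derivD derivX derA.
have RE : R = 2%:R * x * F^`() - F by rewrite derF /R /V /F; ring.
have TR : T %| R.
  have T2 : T %| (S * T ^+ 2)^`().
    rewrite expr2 !derivM; apply: dvdp_add; first by do 2!apply: dvdp_mull.
    by apply: dvdp_mull; apply: dvdp_add; [exact: dvdp_mull | exact: dvdp_mulr].
  (* With [P = F^2 + 2X = S T^2] one has [2 F R = 2X P' - 2 P], and [T] divides both [P] and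
     [P']. *)
  have : T %| 2%:R * F * R.
    have -> : 2%:R * F * R = 2%:R * x * (S * T ^+ 2)^`() - 2%:R * (S * T ^+ 2).
      rewrite -E -/F derivD derivM -polyC_natr derivC mul0r add0r derivX polyC_natr mulr1.
      by rewrite expr2 derivM RE; ring.
    by apply: dvdp_sub; [exact: dvdp_mull | do 2!apply: dvdp_mull; exact: dvdp_mulr].
  rewrite -mulrA -polyC_natr mul_polyC dvdpZr // Gauss_dvdpr //.
have [U RU] : exists U, R = U * T by apply/dvdpP.
have sV : (size V <= N.+1)%N.
  rewrite (leq_trans (size_polyD _ _)) // size_polyN sA geq_max leqnn andbT.
  have -> : 4%:R * x * A^`() = 4%:R *: (A^`() * 'X).
    by rewrite -mul_polyC polyC_natr /x; ring.
  apply: leq_trans (size_scale_leq _ _) _; apply: leq_trans (size_polyMleq _ _) _.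
  rewrite size_polyX addn2 /=.
  by have := lt_size_deriv A0; rewrite sA.
have sR : (size R <= (2 * N).+1)%N.
  rewrite (leq_trans (size_polyD _ _)) // geq_max sx; apply/andP; split; last by size_lia.
  by rewrite (leq_trans (size_polyMleq _ _)) // sA; size_lia.
have R0 : R != 0.
  apply/eqP => R0; have /eqP := R0; rewrite /R addr_eq0 => /eqP AV.
  have : A %| x by rewrite -[x]opprK -AV -mulrN dvdp_mulr.
  move=> Ax; have sA2 : (2 < size A)%N by rewrite sA; size_lia.
  have sx2 : (size x <= 2)%N by rewrite sx.
  by have /eqP := poly_dvd_eq0 sA2 sx2 Ax; rewrite (negPf x0).
have U0 : U != 0 by apply: contraNneq R0 => U0; rewrite RU U0 mul0r.
have T_0 : T != 0 by apply: contraNneq R0 => T00; rewrite RU T00 mulr0.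
have sE : size (S * T ^+ 2) = (4 * N).+1.
  have sF2 : size (F ^+ 2) = (4 * N).+1 by rewrite expr2 size_mul // sF; size_lia.
  rewrite -E -/F size_polyDl // sF2.
  by rewrite -polyC_natr mul_polyC size_scale // sx; size_lia.
have S0 : S != 0.
  by apply/eqP => S0; move: sE; rewrite S0 mul0r size_poly0.
have sU : (2 * (size U).-1 <= s)%N.
  move: sE sR; rewrite expr2 RU !size_mul ?mulf_neq0 //.
  have := size_poly_gt0 S; have := size_poly_gt0 T; have := size_poly_gt0 U.
  rewrite S0 T_0 U0; move: (size S) (size T) (size U) sS => a b c sa; size_lia.
have sU2 : (size (U ^+ 2) <= s.+1)%N.
  by rewrite -[size _]prednK ?size_poly_gt0 ?expf_neq0 // size_exp ltnS mulnC.
have main : R ^+ 2 * S = U ^+ 2 * (F ^+ 2 + 2%:R * x).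
  by rewrite E RU; ring.
(* This is [main] modulo [A]: both sides have degree at most [s + 2], below the degree [N] of [A].
   [I2] is the quotient by [A] of what remains. *)
have I1 : x ^+ 2 * S = U ^+ 2 * (x ^+ 2 + 2%:R * x).
  apply/eqP; rewrite -subr_eq0; apply/eqP.
  apply: (@poly_dvd_eq0 _ A _ N); first by rewrite sA.
    rewrite (leq_trans (size_polyD _ _)) // size_polyN geq_max; apply/andP; split.
      have sx2 : (size (x ^+ 2)%R <= 3)%N by rewrite size_polyXn.
      by apply: leq_trans (size_polyM_bound sx2 sS) _; size_lia.
    have sx2 : (size (x ^+ 2 + 2%:R * x)%R <= 3)%N.
      rewrite (leq_trans (size_polyD _ _)) // geq_max size_polyXn leqnn.
      by rewrite -polyC_natr mul_polyC size_scale ?sx.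
    by apply: leq_trans (size_polyM_bound sU2 sx2) _; size_lia.
  apply/dvdpP; exists (U ^+ 2 * (A ^+ 3 + 2%:R * x * A) - (A * V ^+ 2 + 2%:R * V * x) * S).
  apply/eqP; rewrite -subr_eq0; apply/eqP.
  transitivity (R ^+ 2 * S - U ^+ 2 * (F ^+ 2 + 2%:R * x)); last by rewrite main subrr.
  by rewrite /R /F; ring.
have I2 : (A * V ^+ 2 + 2%:R * V * x) * S = U ^+ 2 * (A ^+ 3 + 2%:R * x * A).
  apply: (mulfI A0); apply/eqP; rewrite -subr_eq0; apply/eqP.
  transitivity ((R ^+ 2 * S - U ^+ 2 * (F ^+ 2 + 2%:R * x))
                - (x ^+ 2 * S - U ^+ 2 * (x ^+ 2 + 2%:R * x))).
    by rewrite /R /F; ring.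
  by rewrite main I1 !subrr.
have [Y YE] : exists Y, x * V * S = Y * A.
  apply/dvdpP; rewrite -(dvdpZr _ _ two0) -mul_polyC polyC_natr.
  apply/dvdpP; exists (U ^+ 2 * (A ^+ 2 + 2%:R * x) - V ^+ 2 * S).
  apply/eqP; rewrite -subr_eq0; apply/eqP.
  transitivity ((A * V ^+ 2 + 2%:R * V * x) * S - U ^+ 2 * (A ^+ 3 + 2%:R * x * A)).
    by ring.
  by rewrite I2 subrr.
have sY : (size Y <= s.+2)%N.
  have [->|Y0] := eqVneq Y 0; first by rewrite size_poly0.
  have sYA : size (Y * A) = (size Y + N)%N by rewrite size_mul // sA addnS.
  have sx1 : (size x <= 2)%N by rewrite sx.
  by have := size_polyM_bound (size_polyM_bound sx1 sV) sS; rewrite YE sYA; size_lia.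
(* Multiplying [I2] by [x^2 S] and substituting [x V S = Y A] eliminates [V]. The right side has
   degree at most [2s + 3], below that of [A^2], so both sides vanish, which forces [Y = x U^2] and
   [S = U^2], against [I1]. *)
have I3 : A ^+ 2 * (Y ^+ 2 - x ^+ 2 * S * U ^+ 2) = 2%:R * x ^+ 2 * S * (x * U ^+ 2 - Y).
  apply: (mulfI A0); apply/eqP; rewrite -subr_eq0; apply/eqP.
  transitivity (x ^+ 2 * S * ((A * V ^+ 2 + 2%:R * V * x) * S - U ^+ 2 * (A ^+ 3 + 2%:R * x * A))
    + (Y * A - x * V * S) * (A * (Y * A + x * V * S) + 2%:R * x ^+ 2 * S)).
    by ring.
  by rewrite I2 YE !subrr mulr0 mul0r addr0.
have I4 : 2%:R * x ^+ 2 * S * (x * U ^+ 2 - Y) = 0.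
  apply: (@poly_dvd_eq0 _ (A ^+ 2) _ (2 * N)).
  - by rewrite expr2 size_mul // sA; size_lia.
  - have s1 : (size (x * U ^+ 2 - Y)%R <= s.+2)%N.
      rewrite (leq_trans (size_polyD _ _)) // size_polyN geq_max sY andbT.
      by apply: (size_polyM_bound (a := 1) _ sU2); rewrite sx.
    have s2 : (size (2%:R * x ^+ 2 * S)%R <= s.+3)%N.
      rewrite -polyC_natr -mulrA mul_polyC (leq_trans (size_scale_leq _ _)) //.
      by apply: (size_polyM_bound (a := 2) _ sS); rewrite size_polyXn.
    by apply: leq_trans (size_polyM_bound s2 s1) _; size_lia.
  - by rewrite -I3 dvdp_mulr.
have I5 : x * U ^+ 2 = Y.
  move/eqP: I4; rewrite mulf_eq0 (negPf (_ : 2%:R * x ^+ 2 * S != 0)) /=.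
    by rewrite subr_eq0 => /eqP.
  by rewrite !mulf_neq0 ?expf_neq0.
have I6 : S = U ^+ 2.
  move/eqP: I3; rewrite I4 mulf_eq0 expf_eq0 /= (negPf A0) /= -I5 subr_eq0 => /eqP I3.
  have xU : x ^+ 2 * U ^+ 2 != 0 by rewrite mulf_neq0 ?expf_neq0.
  by apply: (mulfI xU); rewrite -[RHS]/(_ * _); rewrite mulrAC -I3; ring.
move/eqP: I1; rewrite I6 -subr_eq0.
have -> : x ^+ 2 * U ^+ 2 - U ^+ 2 * (x ^+ 2 + 2%:R * x) = - (2%:R * x * U ^+ 2) by ring.
by rewrite oppr_eq0 !mulf_eq0 (negPf two0') (negPf x0) (negPf U0).
Qed.

Lemma dvdp_mup (K : closedFieldType) (p q : {poly K}) :
  p != 0 -> q != 0 -> (forall a, (mup a p <= mup a q)%N) -> p %| q.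
Proof.
move=> p0 q0 pq; have [rs pE] := closed_field_poly_normal p.
have l0 : lead_coef p != 0 by rewrite lead_coef_eq0.
have {}pq a : (count_mem a rs <= mup a q)%N.
  by apply: leq_trans (pq a); rewrite pE mupZ // mu_prod_XsubC.
rewrite pE dvdpZl //; elim: rs q q0 pq {p p0 pE l0} => [|z rs IH] q q0 pq.
  by rewrite big_nil dvd1p.
have : 'X - z%:P %| q.
  by rewrite XsubC_dvd //; apply: leq_trans (pq z); rewrite /= eqxx.
move=> /dvdpP[r qE]; have r0 : r != 0 by apply: contraNneq q0 => r0; rewrite qE r0 mul0r.
rewrite big_cons qE mulrC dvdp_mul2r ?polyXsubC_eq0 //; apply: IH => // a.
have := pq a; rewrite qE mupM ?polyXsubC_eq0 // (@mup_XsubCX _ 1) /=.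
by case: (z == a); lia.
Qed.

Lemma odd_part_square (K : closedFieldType) (p : {poly K}) :
  p != 0 -> exists S T : {poly K}, [/\ S != 0, T != 0, p = S * T ^+ 2 &
    forall a, mup a S = odd (mup a p) /\ mup a T = (mup a p)./2].
Proof.
move=> p0; have [rs pE] := closed_field_poly_normal p.
have l0 : lead_coef p != 0 by rewrite lead_coef_eq0.
have mp a : mup a p = count_mem a rs by rewrite pE mupZ // mu_prod_XsubC.
pose prodX (f : nat -> nat) := \prod_(z <- undup rs) ('X - z%:P) ^+ f (count_mem z rs).
have prodX0 f : prodX f != 0.
  by apply/monic_neq0/monic_prod => z _; rewrite monic_exp ?monicXsubC.
have mprodX f a : f 0%N = 0%N -> mup a (prodX f) = f (count_mem a rs).
  move=> f0; have -> : count_mem a rs = if a \in undup rs then count_mem a rs else 0%N.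
    by rewrite mem_undup; case: ifPn => // /count_memPn.
  rewrite /prodX; elim: (undup rs) (undup_uniq rs) => [|z s IH] /=.
    by rewrite big_nil f0 mupNroot // root1.
  move=> /andP[zs us]; rewrite big_cons mupM ?expf_neq0 ?polyXsubC_eq0 //; last first.
    by apply/monic_neq0/monic_prod => y _; rewrite monic_exp ?monicXsubC.
  rewrite mup_XsubCX IH // inE (eq_sym z a); case: eqP => [->|] //=.
  by rewrite (negPf zs) f0 addn0.
exists (lead_coef p *: prodX (fun n => odd n : nat)), (prodX half); split=> //.
- by rewrite -size_poly_eq0 size_scale // size_poly_eq0.
- rewrite {1}pE -scalerAl -[X in _ *: X](@prodr_undup_exp_count _ _ rs) -prodrXl -big_split /=.
  congr (_ *: _); apply: eq_bigr => z _.
  by rewrite -exprM -exprD muln2 odd_double_half.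
- by move=> a; rewrite mupZ // !mprodX // mp.
Qed.

(** The variable ['X] is the parameter: evaluation at [a] gives the n-th iterate of 0 under
    [x^d + a]. *)
Definition crit_orbit (R : comNzRingType) (d n : nat) : {poly R} :=
  iter n (fun p => p ^+ d + 'X) 0.
Arguments crit_orbit : simpl never.

Definition crit_gap (R : comNzRingType) (d n : nat) (z : R) : {poly R} :=
  z *: crit_orbit R d n.+1 - 'X.

Section CriticalOrbit.

Variables (K : fieldType) (d : nat).
Hypothesis d2 : (2 <= d)%N.

Local Notation orb := (crit_orbit K d).
Local Notation gap := (@crit_gap K d).

Lemma crit_orbitS n : orb n.+1 = orb n ^+ d + 'X.
Proof. by []. Qed.

Lemma crit_orbit_X n : exists p, orb n.+1 = 'X + 'X ^+ 2 * p.
Proof.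
elim: n => [|n [p E]].
  by exists 0; rewrite crit_orbitS /crit_orbit /= expr0n gtn_eqF ?add0r ?mulr0 ?addr0 //; lia.
rewrite crit_orbitS E; exists ((1 + 'X * p) ^+ d * 'X ^+ (d - 2)).
rewrite mulrCA -exprD subnKC // mulrC -exprMn addrC; congr (_ + _ ^+ _); ring.
Qed.

Lemma crit_orbit_size n : orb n.+1 \is monic /\ size (orb n.+1) = (d ^ n).+1.
Proof.
elim: n => [|n [m s]].
  have -> : orb 1 = 'X by rewrite crit_orbitS /crit_orbit /= expr0n gtn_eqF ?add0r //; lia.
  by rewrite monicX size_polyX.
have mX : orb n.+1 ^+ d \is monic by rewrite monic_exp.
have sX : size (orb n.+1 ^+ d) = (d ^ n.+1).+1.
  by rewrite -[LHS]prednK ?size_poly_gt0 ?monic_neq0 // size_exp s /= -expnSr.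
have X_lt : (size ('X : {poly K}) < size (orb n.+1 ^+ d))%N.
  rewrite size_polyX sX ltnS expnS; have : (0 < d ^ n)%N by rewrite expn_gt0; lia.
  by move: (d ^ n)%N => u; nia.
by rewrite crit_orbitS monicE lead_coefDl // (monicP mX) size_polyDl.
Qed.

Lemma crit_gapE n z : gap n z = z *: orb n ^+ d + (z - 1) *: 'X.
Proof. by rewrite /crit_gap crit_orbitS scalerDr scalerBl scale1r addrA. Qed.

Lemma crit_gap_size n z : z != 0 -> size (gap n.+1 z) = (d ^ n.+1).+1.
Proof.
move=> z0; rewrite /crit_gap size_polyDl ?size_polyN size_scale ?(crit_orbit_size _).2 //.
by rewrite size_polyX ltnS -[X in (X < _)%N](expn0 d) ltn_exp2l.
Qed.

Lemma crit_gap_neq0 n z : z != 0 -> gap n.+1 z != 0.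
Proof. by move=> z0; rewrite -size_poly_eq0 crit_gap_size. Qed.

Lemma crit_gap_mup0 n z : z != 1 -> z != 0 -> mup 0 (gap n.+1 z) = 1%N.
Proof.
move=> z1 z0; have [p E] := crit_orbit_X n.+1.
have gE : gap n.+1 z = ((z - 1)%:P + 'X * (z *: p)) * ('X - 0%:P).
  by rewrite /crit_gap E -!mul_polyC polyCB subr0; ring.
rewrite gE mupMr ?(@mup_XsubCX _ 1) ?eqxx //.
by rewrite rootE !hornerE subr_eq0.
Qed.

Lemma crit_orbit_horner n a : (orb n.+1).[a] = (orb n).[a] ^+ d + a.
Proof. by rewrite crit_orbitS !hornerE. Qed.

Lemma iter_gcdn (T : Type) (f : T -> T) (x : T) (a b : nat) :
  (0 < a)%N -> iter a f x = x -> iter b f x = x -> iter (gcdn a b) f x = x.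
Proof.
move=> a0 fa fb; have it c k : iter c f x = x -> iter (k * c) f x = x.
  by move=> fc; elim: k => [|k IH] //; rewrite mulSn iterD IH.
have [u v E _] := egcdnP b a0.
by have := it a u fa; rewrite E addnC iterD it.
Qed.

(* [gap n z] vanishes at [a <> 0] iff the critical orbit of [X^d + a] satisfies
   [F_(n+1) = z^-1 a]; then [F_2] is periodic, and its period divides [n]. *)
Lemma crit_gap_shared n k z y a :
  z ^+ d = 1 -> y ^+ d = 1 -> a != 0 -> (0 < k <= n)%N -> (n, z) != (k, y) ->
  root (gap n z) a -> root (gap k y) a ->
  exists2 j, (0 < j <= n./2)%N & root (gap j z) a.
Proof.
move=> zd yd a0 /andP[k0 kn] nzky nz ky.
pose f (x : K) := x ^+ d + a; pose x2 := f a.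
have o1 : (orb 1).[a] = a.
  by rewrite crit_orbit_horner /crit_orbit /= horner0 expr0n gtn_eqF ?add0r //; lia.
have orbE m : (orb m.+2).[a] = iter m f x2.
  by elim: m => [|m IH]; rewrite crit_orbit_horner ?o1 // IH.
have gapE m c : root (gap m c) a = (c * (orb m.+1).[a] == a).
  by rewrite rootE /crit_gap !hornerE subr_eq0.
have per m c : c ^+ d = 1 -> root (gap m c) a -> iter m f x2 = x2.
  rewrite gapE => cd /eqP E; rewrite -orbE crit_orbit_horner /x2 /f.
  by congr (_ + _); rewrite -[in RHS]E exprMn cd mul1r.
have nk : k != n.
  apply: contraNneq nzky => kn'; rewrite kn' in ky *.
  move: nz ky; rewrite !gapE => /eqP nz /eqP ky.
  have o0 : (orb n.+1).[a] != 0 by apply: contraNneq a0 => o0; rewrite -nz o0 mulr0.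
  by rewrite xpair_eqE eqxx /=; apply/eqP/(mulIf o0); rewrite nz ky.
pose j := gcdn k n; have j0 : (0 < j)%N by rewrite gcdn_gt0 k0.
have jn : iter j f x2 = x2 := iter_gcdn k0 (per _ _ yd ky) (per _ _ zd nz).
(* The period [j] divides [n] and is at most [k < n], so the quotient is at least 2 and
   [j <= n./2]. *)
have [b nE] : exists b, n = (j * b.+2)%N.
  have /dvdnP[b bE] : (j %| n)%N by exact: dvdn_gcdr.
  have : (j <= k)%N by apply: dvdn_leq => //; exact: dvdn_gcdl.
  by exists b.-2; nia.
exists j; first by rewrite j0 /=; nia.
have jm m : iter (m * j) f x2 = x2 by elim: m => [|m IH] //; rewrite mulSn iterD IH.
(* Periodicity starts at [F_2]; it gives [F_(j+1) = F_(n+1)] at [a], so the root passes from level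
   [n] to level [j] with the same [z]. *)
rewrite gapE -(prednK j0) orbE -(jm b.+1) -iterD.
have -> : (j.-1 + b.+1 * j = n.-1)%N by rewrite nE; nia.
by rewrite -orbE prednK // -?gapE //; apply: leq_trans kn.
Qed.

End CriticalOrbit.

Lemma mup_gt0 (K : fieldType) (a : K) (p : {poly K}) :
  p != 0 -> (0 < mup a p)%N = root p a.
Proof. by move=> p0; rewrite -XsubC_dvd // dvdp_XsubCl. Qed.

Lemma sum_pow_lt (d k : nat) : (2 <= d)%N -> (\sum_(j < k) d ^ j.+1 < d ^ k.+1)%N.
Proof.
move=> d2; elim: k => [|k IH]; first by rewrite big_ord0 expn_gt0; lia.
rewrite big_ord_recr /= [X in (_ < X)%N]expnS.
by move: (d ^ k.+1)%N (\sum_(j < k) _)%N IH => u v; nia.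
Qed.

(** * Multiplicities of the roots of the gap polynomials *)

Section Nondegeneracy.

Variables (K : closedFieldType) (d : nat).
Hypotheses (d2 : (2 <= d)%N) (d1K : d.-1%:R != 0 :> K).

Local Notation orb := (crit_orbit K d).
Local Notation gap := (@crit_gap K d).

Definition crit_defect (n : nat) : {poly K} := d%:R * 'X * (orb n)^`() - orb n.

(** As [F_(n+1) = X + O(X^2)], the coefficient of [X] is [d - 1]; here the coprimality of [d - 1]
    and [q] enters. *)
Lemma crit_defect_neq0 n : crit_defect n.+1 != 0.
Proof.
have [p E] := crit_orbit_X K d2 n.
have o1 : (orb n.+1)`_1 = 1 by rewrite E coefD coefX expr2 -mulrA !coefXM /= addr0.
apply/eqP => /(congr1 (fun q : {poly K} => q`_1)) /eqP; rewrite coef0 coefB o1.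
rewrite -polyC_natr -mulrA coefCM coefXM /= coef_deriv o1.
have -> : d%:R * 1 *+ 1 - 1 = d.-1%:R :> K.
  by rewrite mulr1 mulr1n -{1}(prednK (ltnW d2)) -natr1 addrK.
by rewrite (negPf d1K).
Qed.

Lemma crit_defect_size n : (size (crit_defect n.+1) <= (d ^ n).+1)%N.
Proof.
have [m s] := crit_orbit_size K d2 n.
rewrite (leq_trans (size_polyD _ _)) // size_polyN s geq_max leqnn andbT.
rewrite -polyC_natr -mulrA mul_polyC (leq_trans (size_scale_leq _ _)) //.
rewrite (leq_trans (size_polyMleq _ _)) // size_polyX add2n /=.
by have := lt_size_deriv (monic_neq0 m); rewrite s.
Qed.

(** The operator [X g' - g] annihilates the linear term of [g = z F_n^d + (z - 1) X]. *)
Lemma crit_gap_euler n z :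
  'X * (gap n z)^`() - gap n z = z *: (orb n ^+ d.-1 * crit_defect n).
Proof.
have dE : orb n ^+ d = orb n ^+ d.-1 * orb n by rewrite -exprSr prednK // ltnW.
rewrite crit_gapE derivD !derivZ derivX deriv_exp dE /crit_defect.
by rewrite -!mul_polyC -mulr_natl polyCB; ring.
Qed.

(** A root of multiplicity [m] of [g] has multiplicity at least [m - 1] in [X g' - g]. The factor
    [F^(d-1)] there does not vanish at [a], since otherwise [g(a) = (z - 1) a], which is nonzero. *)
Lemma crit_gap_mup n z a :
  z != 0 -> z != 1 -> a != 0 ->
  ((mup a (gap n.+1 z)).-1 <= mup a (crit_defect n.+1))%N.
Proof.
move=> z0 z1 a0; have g0 := crit_gap_neq0 d2 n z0.
have [r0|rN] := boolP (root (gap n.+1 z) a); last by rewrite mupNroot.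
rewrite mup_geq ?crit_defect_neq0 //.
set g := gap n.+1 z in g0 r0 *; set m := mup a g.
have m0 : (0 < m)%N by rewrite mup_gt0.
have gm : ('X - a%:P) ^+ m %| g by rewrite -mup_geq.
have gm' : ('X - a%:P) ^+ m.-1 %| g by apply: dvdp_trans gm; rewrite dvdp_exp2l // leq_pred.
have dgm : ('X - a%:P) ^+ m.-1 %| g^`().
  have /dvdpP[q ->] := gm; rewrite derivM dvdp_add //.
    by rewrite dvdp_mull // dvdp_exp2l // leq_pred.
  by rewrite deriv_exp -mulr_natr dvdp_mull // -mulrA dvdp_mull // dvdp_mulr.
have : ('X - a%:P) ^+ m.-1 %| z *: (orb n.+1 ^+ d.-1 * crit_defect n.+1).
  by rewrite -crit_gap_euler dvdp_sub // dvdp_mull.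
rewrite dvdpZr // Gauss_dvdpr //; apply/coprimep_expl/coprimep_expr.
rewrite coprimep_sym coprimep_XsubC; apply/rootP => o0.
move/rootP: r0; rewrite /g crit_gapE hornerD !hornerZ horner_exp hornerX o0.
rewrite expr0n gtn_eqF ?(ltnW d2) //.
by rewrite mulr0 add0r => /eqP; rewrite mulf_eq0 subr_eq0 (negPf z1) (negPf a0).
Qed.

(** By [crit_gap_shared], it contains every nonzero root that [gap n z] shares with another gap of
    level at most [n]. *)
Definition lower_gaps (n : nat) (z : K) : {poly K} := \prod_(j < n./2) gap j.+1 z.

Lemma lower_gaps_neq0 n z : z != 0 -> lower_gaps n z != 0.
Proof. by move=> z0; apply/prodf_neq0 => j _; exact: crit_gap_neq0. Qed.

(** The degrees form a geometric sum below [d ^ (n./2 + 1)], and [n./2 + 1 <= n - 3] for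
    [n >= 8]. *)
Lemma lower_gaps_size n z :
  z != 0 -> (8 <= n)%N -> (size (lower_gaps n z) <= d ^ (n - 3))%N.
Proof.
move=> z0 n8; apply: (@leq_trans (\sum_(j < n./2) d ^ j.+1).+1).
  apply: (leq_trans (size_poly_prod_leq _ _)); rewrite leq_subLR addnS ltnS.
  rewrite -sum1_card -big_split /=; apply: leq_sum => j _.
  by rewrite crit_gap_size // add1n.
apply: (leq_trans (sum_pow_lt _ d2)); rewrite leq_exp2l //; lia.
Qed.

(* Were the conclusion false, every root [a <> 0] of the gap would be multiple or
   shared with [lower_gaps], so the gap would divide
   ['X * lower_gaps * crit_defect ^+ 2]; for [n >= 8], [lower_gaps] has negligible
   degree, and this is too small if [d >= 3]. If [d = 2], all multiplicities
   outside [lower_gaps] are even and [no_square_cofactor] applies. *)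
Lemma crit_gap_top n z e c :
  (8 <= n)%N -> z ^+ d = 1 -> z != 1 -> (e %| d)%N -> e%:R != 0 :> K -> (0 < c < e)%N ->
  exists a, [/\ a != 0, root (gap n z) a, ~~ root (lower_gaps n z) a &
    ~~ (e %| c * mup a (gap n z))%N].
Proof.
move=> n8 zd z1 ed eK /andP[c0 ce].
apply: contrapT => noa.
have z0 : z != 0.
  by apply/eqP => z0; move/eqP: zd; rewrite z0 expr0n gtn_eqF ?(ltnW d2) // eq_sym oner_eq0.
have nE : exists k, n = k.+4 by exists (n - 4)%N; lia.
have [k kE] := nE.
have g0 : gap n z != 0 by rewrite kE crit_gap_neq0.
have gs : size (gap n z) = (d ^ n).+1 by rewrite kE crit_gap_size.
have gm0 : mup 0 (gap n z) = 1%N by rewrite kE crit_gap_mup0.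
have key a : a != 0 -> root (gap n z) a -> root (lower_gaps n z) a \/ (e %| c * mup a (gap n z))%N.
  move=> a0 ra; case: (boolP (root (lower_gaps n z) a)) => rl; [by left | right].
  by apply: contraT => nd; case: noa; exists a.
have mX : (0 < mup 0 ('X : {poly K}))%N by rewrite mup_gt0 ?polyX_eq0 // rootX.
have L0 := lower_gaps_neq0 n z0.
have Ls := lower_gaps_size z0 n8.
have u0 : (4 < d ^ (n - 3))%N.
  apply: (@leq_trans (2 ^ (n - 3))); last by rewrite leq_exp2r //; lia.
  by apply: (@leq_trans (2 ^ 3)) => //; rewrite leq_exp2l //; lia.
have sX : (size ('X : {poly K}) <= 2)%N by rewrite size_polyX.
have u1 : (size (lower_gaps n z) <= (d ^ (n - 3)).-1.+1)%N.
  by apply: leq_trans Ls _; move: u0; clear; lia.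
have [d_eq2|d_neq2] := eqVneq d 2.
  have e2 : e = 2%N.
    by apply/eqP; rewrite eqn_leq dvdn_leq //; move: ed; rewrite d_eq2 //; lia.
  have c1 : c = 1%N by lia.
  have zN1 : z = -1.
    move/eqP: zd; rewrite d_eq2 -subr_eq0 -[X in _ - X](expr1n _ 2) subr_sqr mulf_eq0.
    by rewrite subr_eq0 (negPf z1) addr_eq0 => /eqP.
  have [S [T [S0 T0 gST mST]]] := odd_part_square g0.
  (* [S] has only simple roots, at the points of odd multiplicity; by [key] these are 0 or roots of
     [lower_gaps]. *)
  have SL : S %| 'X * lower_gaps n z.
    apply: dvdp_mup => // [|a]; first by rewrite mulf_neq0 ?polyX_eq0.
    rewrite mupM ?polyX_eq0 // (mST a).1; have [->|a0] := eqVneq a 0.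
      by rewrite gm0 /= addn_gt0 mX.
    case: (boolP (odd _)) => // odd_m.
    have ra : root (gap n z) a by rewrite -mup_gt0 // odd_gt0.
    have [rl|] := key a a0 ra; first by rewrite addn_gt0 (mup_gt0 _ L0) rl orbT.
    by rewrite c1 e2 mul1n dvdn2 odd_m.
  have Ss : (size S <= (d ^ (n - 3)).+1)%N.
    apply: (leq_trans (dvdp_leq _ SL)); first by rewrite mulf_neq0 ?polyX_eq0.
    by apply: (leq_trans (size_polyM_bound sX u1)); move: u0; clear; lia.
  have T00 : T.[0] != 0.
    by apply/negP => T00; have := mup_gt0 0 T0; rewrite rootE T00 (mST 0).2 gm0.
  have [m s] := crit_orbit_size K d2 k.+2.
  have two0 : 2%:R != 0 :> K by rewrite -e2.
  have S0' : (size (- S) <= (d ^ (n - 3)).+1)%N by rewrite size_polyN.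
  apply: (no_square_cofactor two0 s S0' _ T00).
    have nk : (n - 3 = k.+1)%N by rewrite kE.
    rewrite nk in u0 *; rewrite [X in (_ < X)%N]expnS.
    by move: (d ^ k.+1)%N u0 d2 => u; clear; nia.
  (* For [z = -1], [- gap n z] is [F_n^2 + 2X], and [F_n = A^2 + X] with [A = F_(n-1)]. *)
  have -> : - S * T ^+ 2 = - gap n z by rewrite mulNr -gST.
  rewrite crit_gapE zN1 kE d_eq2 !crit_orbitS -!mul_polyC.
  by rewrite !polyCB !polyCN; ring.
pose D := crit_defect n; have D0 : D != 0 by rewrite /D kE crit_defect_neq0.
have Ds : (size D <= (d ^ n.-1).+1)%N by rewrite /D kE crit_defect_size.
(* At a nonzero root outside [lower_gaps] the multiplicity [m] is not 1, because [e] does not divide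
   [c]; hence [m <= 2 * (m - 1)], which [D^2] covers. At 0 the root is simple. *)
have : gap n z %| 'X * lower_gaps n z * D ^+ 2.
  apply: dvdp_mup => // [|a]; first by rewrite !mulf_neq0 ?expf_neq0 ?polyX_eq0.
  rewrite !mupM ?mulf_neq0 ?expf_neq0 ?polyX_eq0 //.
  have [->|a0] := eqVneq a 0.
    by rewrite gm0 -addnA addn_gt0 mX.
  have [ra|/mupNroot->//] := boolP (root (gap n z) a).
  have mD : ((mup a (gap n z)).-1 <= mup a D)%N by rewrite /D kE crit_gap_mup.
  have m0 : (0 < mup a (gap n z))%N by rewrite mup_gt0.
  have [rl|ecm] := key a a0 ra.
    have : (0 < mup a (lower_gaps n z))%N by rewrite mup_gt0.
    by move: (mup _ _) (mup _ _) (mup _ _) (mup _ _) mD m0 => m1 m2 m3 m4; clear; lia.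
  have m1 : mup a (gap n z) != 1%N.
    by apply: contraTneq ecm => ->; rewrite muln1 gtnNdvd.
  by move: (mup _ _) (mup _ _) (mup _ _) (mup _ _) mD m0 m1 => m2 m3 m4 m5; clear; lia.
move=> /dvdp_leq; rewrite !mulf_neq0 ?expf_neq0 ?polyX_eq0 // gs => /(_ isT).
move=> /leq_trans/(_ (size_polyM_bound (size_polyM_bound sX u1) (size_polyX_bound 2 Ds))).
have -> : (d ^ n = d * (d * (d * d ^ (n - 3))))%N.
  by rewrite -!expnS kE.
have -> : (d ^ n.-1 = d * (d * d ^ (n - 3)))%N.
  by rewrite -!expnS kE.
(* With [u = d^(n-3)], the degree [d^n >= 3 d^(n-1)] would be at most [u + 2 d^(n-1)], but
   [d^(n-1) = d^2 u > u]. *)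
have d3 : (3 <= d)%N by move: d2 d_neq2; clear; lia.
move: (d ^ (n - 3))%N u0 => u u0.
have h1 : (3 * (d * (d * u)) <= d * (d * (d * u)))%N by rewrite leq_mul2r d3 orbT.
have h2 : (9 * u <= d * (d * u))%N by rewrite mulnA leq_mul2r (leq_mul d3 d3) orbT.
by move: u0 h1 h2; clear; lia.
Qed.

End Nondegeneracy.

Lemma mup_prod (K : fieldType) (I : finType) (a : K) (f : I -> {poly K}) :
  (forall i, f i != 0) -> mup a (\prod_i f i) = (\sum_i mup a (f i))%N.
Proof.
move=> f0; elim: (index_enum I) => [|i s IH].
  by rewrite !big_nil mupNroot // root1.
by rewrite !big_cons mupM ?IH // prodf_seq_neq0; apply/allP => j _; exact: f0.
Qed.

(** Among the factors with nonzero exponent take one of maximal level. The root that [crit_gap_top]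
    provides for it lies outside [lower_gaps], so no other factor with nonzero exponent vanishes
    there and the total multiplicity is [v t0] times that of this factor. *)
Lemma crit_gap_family_nondegenerate (K : closedFieldType) (d e l N : nat) (J : finType)
    (zeta : J -> K) (v : 'I_N * J -> 'I_e) :
  (2 <= d)%N -> d.-1%:R != 0 :> K -> (e %| d)%N -> e%:R != 0 :> K -> (8 <= l)%N ->
  injective zeta -> (forall j, zeta j ^+ d = 1) -> (forall j, zeta j != 1) ->
  (exists t, v t != 0 :> nat) ->
  exists a, ~~ (e %| mup a (\prod_(t : 'I_N * J) crit_gap d (l + t.1) (zeta t.2) ^+ v t))%N.
Proof.
move=> d2 d1K ed eK l8 zinj zd z1 [t1 vt1].
have [t0 vt0 tmax] := @arg_maxnP _ t1 (fun t => v t != 0 :> nat) (fun t => t.1 : nat) vt1.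
have z0 j : zeta j != 0.
  apply/eqP => zj; move/eqP: (zd j).
  by rewrite zj expr0n gtn_eqF ?(ltnW d2) // eq_sym oner_eq0.
have n8 : (8 <= l + t0.1)%N by apply: leq_trans l8 (leq_addr _ _).
have v0e : (0 < v t0 < e)%N by rewrite lt0n vt0 ltn_ord.
have [a [a0 ra nla nda]] := crit_gap_top d2 d1K n8 (zd t0.2) (z1 t0.2) ed eK v0e.
exists a.
have gn0 n j : (8 <= n)%N -> crit_gap d n (zeta j) != 0.
  by case: n => // n _; exact: crit_gap_neq0.
have g0 (t : 'I_N * J) : crit_gap d (l + t.1) (zeta t.2) != 0.
  by apply: gn0; apply: leq_trans l8 (leq_addr _ _).
rewrite mup_prod => [|t]; last by rewrite expf_neq0.
rewrite (bigD1 t0) //= mupX // big1 ?addn0 // => t tt0; rewrite mupX //.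
have [->|vt] := eqVneq (v t : nat) 0%N; first by rewrite mul0n.
rewrite (@mupNroot _ _ (crit_gap _ _ _)) ?muln0 //.
apply: contra nla => rt.
have lt0 : (0 < l + t.1 <= l + t0.1)%N.
  by rewrite leq_add2l addn_gt0 (leq_trans _ l8) //=; exact: tmax.
have pairs : (l + t0.1, zeta t0.2)%N != (l + t.1, zeta t.2)%N.
  apply: contra tt0 => /eqP[/addnI/val_inj E1 /zinj E2].
  by case: t t0 E1 E2 {tmax vt0 v0e n8 ra nda rt lt0 vt} => [i j] [i0 j0] /= -> ->.
have [j jn rj] := crit_gap_shared d2 (zd t0.2) (zd t.2) a0 lt0 pairs ra rt.
case: j jn rj => // j jn rj.
by rewrite /lower_gaps (bigD1 (Ordinal jn)) //= rootM rj.
Qed.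

(** * Functional graphs *)

Section UnicriticalGraph.

Variables (F : finFieldType) (d e c : nat) (w : F).
Hypotheses (d0 : (0 < d)%N) (Fe : #|F| = (e * c).+1) (eE : gcdn d (e * c) = e)
  (wP : e.-primitive_root w).

Lemma unit_expr_card (x : F) : x != 0 -> x ^+ (e * c) = 1.
Proof. by move=> x0; apply: (mulfI x0); rewrite -exprS -Fe expf_card mulr1. Qed.

Lemma unity_root_gcd (x : F) : x ^+ d = 1 -> x ^+ e = 1.
Proof.
move=> xd; have x0 : x != 0.
  by apply/eqP => x0; move/eqP: xd; rewrite x0 expr0n gtn_eqF // eq_sym oner_eq0.
have [u v E _] := egcdnP (e * c) d0.
have := congr1 (fun n => x ^+ n) E; rewrite /= exprD eE mulnC exprM xd expr1n.
by rewrite mulnC exprM unit_expr_card // expr1n mul1r.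
Qed.

Lemma prim_root_exprd : w ^+ d = 1.
Proof.
have /dvdnP[k ->] := dvdn_gcdl d (e * c).
by rewrite eE mulnC exprM (prim_expr_order wP) expr1n.
Qed.

Lemma prim_root_neq1 : (1 < e)%N -> w != 1.
Proof.
move=> e1; have := eq_prim_root_expr wP 1 0; rewrite expr1 expr0 => ->.
by rewrite mod0n modn_small.
Qed.

Lemma same_power (x y : F) : y != 0 -> x ^+ d = y ^+ d -> exists i : 'I_e, x = w ^+ i * y.
Proof.
move=> y0 xy; have : (x / y) ^+ d = 1 by rewrite expr_div_n xy divff // expf_neq0.
by move=> /unity_root_gcd/(prim_rootP wP)[i E]; exists i; rewrite -E divfK.
Qed.

(** As [e] is the gcd of [d] and [q - 1 = e * c], the nonzero d-th powers are the e-th powers, which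
    form the kernel of the c-th power map. *)
Lemma power_residueP (z : F) : z != 0 -> (exists y, y ^+ d = z) <-> z ^+ c = 1.
Proof.
move=> z0; split=> [[y yd]|zc].
  have y0 : y != 0 by apply: contraNneq z0 => y0; rewrite -yd y0 expr0n gtn_eqF.
  have /dvdnP[k dk] : (e %| d)%N by rewrite -eE dvdn_gcdl.
  by rewrite -yd -exprM dk -mulnA mulnC exprM unit_expr_card // expr1n.
have [g gP] : exists g : F, (e * c).-primitive_root g.
  by apply: (@finField_prim_root F (e * c) 1); rewrite muln1.
have ec0 := prim_order_gt0 gP.
have c0 : (0 < c)%N by move: ec0; rewrite muln_gt0 => /andP[].
have [i zi] := prim_rootP gP (unit_expr_card z0).
have : g ^+ (i * c) = 1 by rewrite exprM -zi.
move/eqP; rewrite -(prim_order_dvd gP) dvdn_pmul2r // => /dvdnP[k ik].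
have [u v E _] := egcdnP (e * c) d0.
exists (g ^+ (u * k)); rewrite -exprM mulnAC E eE mulnDl exprD (mulnC v) -mulnA.
by rewrite [g ^+ (e * c * _)]exprM (prim_expr_order gP) expr1n mul1r zi ik mulnC.
Qed.

Local Notation f a := (fun x : F => x ^+ d + a).

Definition preimage_count (h : F -> F) (y : F) : nat :=
  #|[set v | (h v == y) && [exists u, h u == v]]%SET|.

Lemma orbit_horner k a : (crit_orbit F d k).[a] = iter k (f a) 0.
Proof. by elim: k => [|k IH]; rewrite ?horner0 // /crit_orbit /= !hornerE -IH. Qed.

Lemma conj_preimage_count (h1 h2 : F -> F) (s : {perm F}) y :
  (forall u, s (h1 u) = h2 (s u)) -> preimage_count h1 y = preimage_count h2 (s y).
Proof.
move=> sh; rewrite /preimage_count -(card_imset _ (@perm_inj _ s)).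
apply: eq_card => v; rewrite !inE; apply/imsetP/idP => [[v' + ->]|].
  rewrite inE => /andP[/eqP <- /existsP[u /eqP <-]]; rewrite -sh eqxx.
  by apply/existsP; exists (s u); rewrite sh.
move=> /andP[hv /existsP[u hu]]; exists (s^-1%g v); last by rewrite permKV.
rewrite inE; apply/andP; split.
  by rewrite -(inj_eq (@perm_inj _ s)) sh permKV.
by apply/existsP; exists (s^-1%g u); rewrite -(inj_eq (@perm_inj _ s)) sh !permKV.
Qed.

(* [0] is the only point [y] whose fibre [f @^-1 (f y)] is a singleton. *)
Lemma conj_critical (a b : F) (s : {perm F}) :
  (1 < e)%N -> (forall u, s (f a u) = f b (s u)) -> s 0 = 0.
Proof.
move=> e1 sh; apply/eqP; apply: contraT => s0.
pose x := s^-1%g (w * s 0).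
have : f b (s x) = f b (s 0) by rewrite /x permKV /= exprMn prim_root_exprd mul1r.
rewrite -!sh => /perm_inj/addIr; rewrite expr0n gtn_eqF //= => /eqP.
rewrite expf_eq0 d0 /= => /eqP x0; move: (congr1 s x0); rewrite /x permKV => ws.
have /eqP : w * s 0 - s 0 = 0 by rewrite ws subrr.
rewrite -[X in _ - X]mul1r -mulrBl mulf_eq0 (negPf s0) orbF subr_eq0.
by rewrite (negPf (prim_root_neq1 e1)).
Qed.

Lemma conj_orbit (a b : F) (s : {perm F}) k :
  (1 < e)%N -> (forall u, s (f a u) = f b (s u)) ->
  s (iter k (f a) 0) = iter k (f b) 0.
Proof.
move=> e1 sh; elim: k => [|k IH] /=; first exact: conj_critical sh.
by rewrite sh IH.
Qed.

(** The fibre consists of the points [w^i F_(n+1)], [i < e]. The one with [i = 0] has the preimage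
    [F_n]; index [j] stands for [i = j + 1], which has a preimage iff the c-th power of its gap is
    1, that is, iff [j < J]. This gives [J + 1] points. *)
Lemma orbit_preimage_count (a : F) (n J : nat) :
  (crit_orbit F d n.+1).[a] != 0 -> (J < e)%N ->
  (forall j : 'I_e.-1, (crit_gap d n (w ^+ j.+1)).[a] != 0 /\
     (crit_gap d n (w ^+ j.+1)).[a] ^+ c = w ^+ (J <= j)%N) ->
  preimage_count (f a) (iter n.+2 (f a) 0) = J.+1.
Proof.
move=> o0 Je gP; pose o := (crit_orbit F d n.+1).[a]; have e0 := prim_order_gt0 wP.
have gapE z : (crit_gap d n z).[a] = z * o - a.
  by rewrite /crit_gap hornerD hornerN hornerZ hornerX.
pose W (j : 'I_e) := w ^+ j * o.
have W_inj : injective W.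
  move=> i j /(mulIf o0)/eqP.
  by rewrite (eq_prim_root_expr wP) !modn_small // => /eqP/val_inj.
have preW (j : 'I_e) : [exists u, f a u == W j] = (j <= J)%N.
  have -> : [exists u, f a u == W j] = [exists u, u ^+ d == W j - a].
    by apply: eq_existsb => u; rewrite [RHS]eq_sym subr_eq eq_sym.
  case: j => -[|j] /= je.
    apply/existsP; exists (iter n (f a) 0); apply/eqP.
    by rewrite /W /= expr0 mul1r /o orbit_horner /= addrK.
  have je' : (j < e.-1)%N by lia.
  have [g0 gc] := gP (Ordinal je'); rewrite /= gapE in g0 gc.
  have [PR1 PR2] := power_residueP g0.
  apply/existsP/idP => [[u /eqP/(ex_intro _ u)/PR1]|jJ].
    rewrite gc; case: (leqP J j) => [Jj|//]; rewrite expr1 => w1.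
    by move: (prim_root_neq1 (leq_ltn_trans (ltn0Sn j) je)); rewrite w1 eqxx.
  have [u /eqP ud] : exists u, u ^+ d = w ^+ j.+1 * o - a.
    by apply: PR2; rewrite gc leqNgt jJ expr0.
  by exists u.
have -> : J.+1 = #|W @: [set j : 'I_e | (j <= J)%N]|.
  rewrite card_imset // -sum1_card (eq_bigl (fun j : 'I_e => (j < J.+1)%N)) => [|j].
    by rewrite (big_ord_narrow Je) sum1_card card_ord.
  by rewrite inE.
apply: eq_card => v; rewrite !inE; apply/andP/imsetP => [[/eqP fv ex]|[j]].
  have vo : v ^+ d = o ^+ d.
    by move: fv; rewrite iterS -orbit_horner => /addIr.
  have [j vE] := same_power o0 vo; exists j => //.
  by rewrite inE -preW; move: ex; rewrite vE.
rewrite inE -preW => ex ->; split=> //.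
by rewrite iterS -orbit_horner -/o /W exprMn exprAC prim_root_exprd expr1n mul1r.
Qed.

End UnicriticalGraph.

(** * From residue patterns to pairwise non-isomorphic graphs *)

Lemma card_equivalence_partition_geq (T J : finType) (R : rel T) (A : {set T})
    (h : J -> T) :
  equivalence_rel R -> (forall j, h j \in A) ->
  (forall i j, R (h i) (h j) -> i = j) ->
  (#|J| <= #|equivalence_partition R A|)%N.
Proof.
move=> eqR hA hR; have eqRA : {in A & &, equivalence_rel R}.
  by move=> x y z _ _ _; exact: eqR.
have eqi := equivalence_partitionP eqRA.
pose cl j := finset.pblock (equivalence_partition R A) (h j).
have clP j : h j \in cl j by rewrite mem_pblock (cover_partition eqi).
have cl_inj : injective cl.
  move=> i j clij; apply: hR; rewrite -(pblock_equivalence_partition eqRA) //.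
  by rewrite -/(cl i) clij.
rewrite -[#|J|]cardsT -(card_imset _ cl_inj).
apply: subset_leq_card; apply/fintype.subsetP => B /imsetP[j _ ->].
by rewrite pblock_mem -?mem_pblock ?clP.
Qed.

Lemma functional_graph_isoP (V : finType) (f1 f2 : V -> V) :
  digraph_iso (functional_graph f1) (functional_graph f2) ->
  exists s : {perm V}, forall u, s (f1 u) = f2 (s u).
Proof.
move=> /existsP[s /forallP H]; exists s => u.
have /forallP/(_ (f1 u)) := H u; rewrite /functional_graph !inE /= eqxx.
by move=> /eqP/eqP.
Qed.

Lemma nat_sqrt_exists (q : nat) : exists M, (M * M <= q < M.+1 * M.+1)%N.
Proof.
have ex : exists M, (M * M <= q)%N by exists 0.
have ub M : (M * M <= q)%N -> (M <= q)%N by case: M => // M; nia.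
have [M MM Mmax] := ex_maxnP ex ub.
by exists M; rewrite MM /= ltnNge; apply/negP => /Mmax; rewrite ltnn.
Qed.

Lemma num_poly_graphs_gt0 (F : finFieldType) (d : nat) :
  (2 <= d)%N -> (0 < num_poly_graphs F d)%N.
Proof.
move=> d2; have eqD := @digraph_iso_equiv F.
suff [G GA] : exists G, G \in poly_graphs F d.
  have := @card_equivalence_partition_geq _ unit _ (poly_graphs F d) (fun=> G) eqD.
  by rewrite card_unit; apply=> // -[] [].
have sz : (size ('X^d : {poly F}) <= d.+1)%N by rewrite size_polyXn.
exists (functional_graph (horner 'X^d)); apply/imsetP.
by exists (NPoly sz) => //; rewrite inE /= size_polyXn.
Qed.

Lemma unicritical_graph (F : finFieldType) (d : nat) (a : F) :
  (2 <= d)%N ->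
  functional_graph (fun x : F => x ^+ d + a) \in poly_graphs F d.
Proof.
move=> d2; pose p : {poly F} := 'X^d + a%:P.
have szp : size p = d.+1.
  rewrite size_polyDl ?size_polyXn //.
  by apply: leq_ltn_trans (size_polyC_leq1 _) _; rewrite ltnS ltnW.
have szp' : (size p <= d.+1)%N by rewrite szp.
apply/imsetP; exists (NPoly szp'); first by rewrite inE /= szp.
by apply/setP => -[u v]; rewrite !inE /= !hornerE.
Qed.

Lemma sum_pow_shift_leq (d l N : nat) :
  (2 <= d)%N -> (\sum_(i < N) d ^ (l + i) <= d ^ (l + N))%N.
Proof.
move=> d2; elim: N => [|N IH]; first by rewrite big_ord0.
rewrite big_ord_recr /= addnS expnS.
by move: (d ^ (l + N))%N (\sum_(i < N) _)%N IH => u v; nia.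
Qed.

(** All terms are of order at most [E * d * m * M], while [d^2 * E * m] is at most [M / 100]. The
    application with [l = 10] is the origin of the constant [100 * d ^ 12]. *)
Lemma pattern_bound_arith (d e N l q M m E : nat) :
  (e <= d)%N -> (0 < e)%N -> (0 < E)%N -> m = (d ^ (l + N))%N -> (8 <= m)%N ->
  (M * M <= q)%N -> (100 * d ^ l.+2 * (E * d ^ N) <= M)%N ->
  (4 * e * (m + 3) <= M)%N /\ (E * (e * (3 * m + 4) * (M + 2) + m) + m < q)%N.
Proof.
move=> ed e0 E0 mE m8 Mq HM.
have {HM} HM : (100 * (d * d) * (E * m) <= M)%N.
  apply: leq_trans HM; rewrite mE !expnS expnD; apply: eq_leq; ring.
have d0 : (0 < d)%N by apply: leq_trans ed.
have dm : (100 * (d * m) <= M)%N.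
  apply: leq_trans HM; rewrite -!mulnA leq_mul2l /= leq_mul2l; apply/orP; right.
  by rewrite mulnCA; apply: leq_trans (leq_pmulr _ E0) _; rewrite mulnC leq_mul2l leq_pmull ?orbT.
have em : (e * m <= d * m)%N by rewrite leq_mul2r ed orbT.
have dE : (m <= d * m)%N by rewrite leq_pmull.
split.
  have : (e * (m + 3) <= 2 * (d * m))%N.
    apply: (@leq_trans (e * (2 * m))); first by rewrite leq_mul2l; apply/orP; right; lia.
    by rewrite mulnCA leq_mul2l.
  rewrite -mulnA; lia.
have M2 : (M + 2 <= 2 * M)%N by lia.
have t1 : (e * (3 * m + 4) <= 4 * (d * m))%N.
  apply: (@leq_trans (e * (4 * m))); first by rewrite leq_mul2l; apply/orP; right; lia.
  by rewrite mulnCA leq_mul2l.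
have t2 : (e * (3 * m + 4) * (M + 2) <= 8 * (d * m * M))%N.
  by apply: leq_trans (leq_mul t1 M2) _; apply: eq_leq; ring.
have M0 : (0 < M)%N by lia.
have t3 : (m <= d * m * M)%N by apply: leq_trans dE (leq_pmulr _ M0).
have t4 : (E * (e * (3 * m + 4) * (M + 2) + m) <= E * (9 * (d * m * M)))%N.
  by rewrite leq_mul2l; apply/orP; right; lia.
have t5 : (m <= E * (d * m * M))%N by apply: leq_trans t3 (leq_pmull _ E0).
apply: (@leq_ltn_trans (10 * (E * (d * m * M)))); first by lia.
apply: leq_trans Mq; apply: (@leq_trans (100 * (d * d) * (E * m) * M)).
  have -> : (100 * (d * d) * (E * m) * M = 100 * (d * (E * (d * m * M))))%N by ring.
  have : (E * (d * m * M) <= d * (E * (d * m * M)))%N by rewrite leq_pmull.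
  lia.
by rewrite leq_mul2r HM orbT.
Qed.

Lemma map_crit_orbit (R S : comNzRingType) (phi : {rmorphism R -> S}) (d n : nat) :
  map_poly phi (crit_orbit R d n) = crit_orbit S d n.
Proof.
elim: n => [|k IH]; first exact: rmorph0.
by rewrite /crit_orbit !iterS -/(crit_orbit R d k) rmorphD rmorphXn /= map_polyX IH.
Qed.

Lemma map_crit_gap (R S : comNzRingType) (phi : {rmorphism R -> S}) (d n : nat) (z : R) :
  map_poly phi (crit_gap d n z) = crit_gap d n (phi z).
Proof. by rewrite /crit_gap -(map_crit_orbit phi) rmorphB /= map_polyZ map_polyX. Qed.

(** There are [e^((e-1)N)] exponent vectors and the degrees are of order [d^N]; their product must
    stay below the square root of [q]. Levels start at 8 because of [crit_gap_top]. *)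
Lemma gap_pattern_exists (F : finFieldType) (p k d e c N : nat) (w : F)
    (u : 'I_N -> 'I_e.-1 -> nat) :
  prime p -> (0 < k)%N -> #|F| = (p ^ k)%N -> #|F| = (e * c).+1 ->
  gcdn d.-1 #|F| = 1%N -> (2 <= d)%N -> (2 <= e)%N -> (e %| d)%N ->
  e.-primitive_root w ->
  ((100 * d ^ 12 * (e ^ e.-1 * d) ^ N) ^ 2 <= #|F|)%N ->
  exists x : F, forall i : 'I_N, (crit_orbit F d (8 + i).+1).[x] != 0 /\
    forall j : 'I_e.-1, (crit_gap d (8 + i) (w ^+ j.+1)).[x] != 0 /\
      (crit_gap d (8 + i) (w ^+ j.+1)).[x] ^+ c = w ^+ u i j.
Proof.
move=> pp k0 Fpk Fe gd d2 e2 ed wP bound.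
have [K [phi _]] := countable_algebraic_closure F.
have pF : p \in [pchar F] by apply: card_finPcharP Fpk pp.
have pK : p \in [pchar K] by apply: rmorph_pchar pF.
have qK : [pchar K].-nat #|F| by rewrite Fpk pnatX (eq_pnat _ (pcharf_eq pK)) pnat_id.
have natK n : coprime n #|F| -> n%:R != 0 :> K.
  move=> cn; rewrite -(dvdn_pcharf pK); apply/negP => pn.
  have : (p %| gcdn n #|F|)%N by rewrite dvdn_gcd pn Fpk dvdn_exp.
  by rewrite (eqP cn) dvdn1 => /eqP p1; rewrite p1 in pp.
have d1K : d.-1%:R != 0 :> K by apply/natK/eqP.
have eK : e%:R != 0 :> K by apply: natK; rewrite Fe /coprime -addn1 mulnC gcdnMDl gcdn1.
have wn1 (j : 'I_e.-1) : w ^+ j.+1 != 1.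
  by rewrite -(expr0 w) (eq_prim_root_expr wP) mod0n modn_small // -ltn_predRL.
have wd j : (w ^+ j) ^+ d = 1.
  by have /dvdnP[a ->] := ed; rewrite exprAC mulnC exprM (prim_expr_order wP) !expr1n.
have w0 n : w ^+ n != 0.
  rewrite expf_neq0 //; apply/eqP => w0; have := prim_expr_order wP.
  by rewrite w0 expr0n gtn_eqF ?(prim_order_gt0 wP) // => /esym/eqP; rewrite oner_eq0.
pose zeta (j : 'I_e.-1) : K := phi (w ^+ j.+1).
have zinj : injective zeta.
  move=> i j /fmorph_inj/eqP; rewrite (eq_prim_root_expr wP) !modn_small; last 2 first.
  - by rewrite -ltn_predRL.
  - by rewrite -ltn_predRL.
  by move=> /eqP[/val_inj].
have zd j : zeta j ^+ d = 1 by rewrite -rmorphXn /= wd rmorph1.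
have z1 j : zeta j != 1 by rewrite fmorph_eq1.
pose I : finType := ('I_N * 'I_e.-1)%type.
pose g (t : I) : {poly F} := crit_gap d (8 + t.1) (w ^+ t.2.+1).
pose O : {poly F} := \prod_(i < N) crit_orbit F d (8 + i).+1.
(* The factor [O] keeps [F_(n+1)] nonzero, so that the fibres counted later have [e] points. *)
pose Z := O * \prod_t g t.
have gs t : size (g t) = (d ^ (8 + t.1)).+1 by rewrite /g crit_gap_size.
have g0 t : g t != 0 by rewrite -size_poly_eq0 gs.
have os i : size (crit_orbit F d i.+1) = (d ^ i).+1 := (crit_orbit_size F d2 i).2.
have o0 i : crit_orbit F d i.+1 != 0 by rewrite -size_poly_eq0 os.
have Z0 : Z != 0 by rewrite mulf_neq0 //; apply/prodf_neq0 => t _.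
pose T := (\sum_(i < N) d ^ (8 + i))%N.
have T_le : (T <= d ^ (8 + N))%N by exact: sum_pow_shift_leq.
have sumI (f : nat -> nat) : (\sum_(t : I) f t.1 = e.-1 * \sum_(i < N) f i)%N.
  rewrite big_distrr /= -(pair_bigA _ (fun (i : 'I_N) (j : 'I_e.-1) => f i)) /=.
  by apply: eq_bigr => i _; rewrite sum_nat_const card_ord.
have e_le_d : (e <= d)%N by rewrite dvdn_leq // ltnW.
(* Exponents below [e] and the [e - 1] roots of unity each cost a factor at most [d] on top of
   [T <= d ^ (8 + N)]. *)
pose m := (d ^ (10 + N))%N.
have mE : m = (d * (d * d ^ (8 + N)))%N by rewrite -!expnS.
have Zs : (size Z <= m.+1)%N.
  have Os : (size O <= T.+1)%N.
    apply: (leq_trans (size_poly_prod_leq _ _)); rewrite leq_subLR addnS ltnS.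
    by rewrite -sum1_card -big_split /=; apply: leq_sum => i _; rewrite os add1n.
  have Gs : (size (\prod_t g t)%R <= (e.-1 * T).+1)%N.
    apply: (leq_trans (size_poly_prod_leq _ _)); rewrite leq_subLR addnS ltnS.
    rewrite -(sumI (fun i => d ^ (8 + i))%N) -sum1_card -big_split /=.
    by apply: leq_sum => t _; rewrite gs add1n.
  apply: (leq_trans (size_polyM_bound Os Gs)); rewrite ltnS.
  rewrite -mulSn prednK ?(ltnW e2) // mE.
  apply: leq_trans (leq_mul e_le_d T_le) _.
  by rewrite leq_mul2l leq_pmull ?orbT // ltnW.
have prod_s (v : I -> 'I_e) : (size (\prod_t g t ^+ v t)%R <= m.+1)%N.
  apply: (leq_trans (size_poly_prod_leq _ _)); rewrite leq_subLR addnS ltnS.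
  apply: (@leq_trans (#|I| + \sum_(t : I) e.-1 * d ^ (8 + t.1))%N).
    rewrite -sum1_card -big_split /=; apply: leq_sum => t _.
    apply: (leq_trans (size_polyX_bound (a := d ^ (8 + t.1)) _ _)); first by rewrite gs.
    rewrite add1n ltnS leq_mul2r; apply/orP; right.
    by rewrite -ltnS prednK ?(ltnW e2).
  rewrite leq_add2l (sumI (fun i => e.-1 * d ^ (8 + i))%N) -big_distrr /= mE.
  by rewrite !leq_mul // (leq_trans (leq_pred _)).
have gZ t : g t %| Z by rewrite /Z (bigD1 t) //= dvdp_mull // dvdp_mulr.
have gnd (v : I -> 'I_e) : (exists t, v t != 0 :> nat) ->
    exists a, ~~ (e %| mup a (map_poly phi (\prod_t g t ^+ v t)))%N.
  move=> v0; have [a ha] := crit_gap_family_nondegenerate d2 d1K ed eK (leqnn 8) zinj zd z1 v0.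
  exists a; rewrite rmorph_prod; congr (~~ (e %| mup a _)%N): ha.
  by apply: eq_bigr => t _; rewrite rmorphXn /= map_crit_gap.
have [M /andP[Mq qM]] := nat_sqrt_exists #|F|.
have cardI : #|I| = (N * e.-1)%N by rewrite card_prod !card_ord.
have HM : (100 * d ^ 12 * ((e ^ #|I|) * d ^ N) <= M)%N.
  rewrite cardI mulnC [(N * _)%N]mulnC expnM -expnMn mulnC.
  rewrite -ltnS -ltn_sqr; apply: leq_ltn_trans bound _.
  by rewrite -mulnn.
have m8 : (8 <= m)%N.
  apply: (@leq_trans (2 ^ 3)) => //; apply: (@leq_trans (2 ^ (10 + N))).
    by rewrite leq_exp2l //; lia.
  by rewrite leq_exp2r //; lia.
have E0 : (0 < e ^ #|I|)%N by rewrite expn_gt0 (ltnW e2).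
have [H1 H2] := pattern_bound_arith e_le_d (ltnW e2) E0 erefl m8 Mq HM.
have MM : (M * M <= #|F| < M.+1 * M.+1)%N by rewrite Mq.
have [x Zx xu] := residue_pattern_exists (fun t : I => u t.1 t.2) Fe qK wP gZ Z0 Zs prod_s
  gnd MM H1 H2.
move: Zx; rewrite hornerM mulf_eq0 negb_or !horner_prod => /andP[Ox gx].
exists x => i; split; first by have /prodf_neq0/(_ i isT) := Ox.
move=> j; split; first by have /prodf_neq0/(_ (i, j) isT) := gx.
exact: (xu (i, j)).
Qed.

(** For each [J] from ['I_N] to ['I_e] a parameter is chosen whose preimage counts along the
    critical orbit are [J i + 1]. An isomorphism preserves these counts, so distinct [J] give
    non-isomorphic graphs. *)
Lemma num_poly_graphs_geq (F : finFieldType) (p k d e N : nat) :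
  prime p -> (0 < k)%N -> #|F| = (p ^ k)%N -> gcdn d.-1 #|F| = 1%N ->
  (2 <= d)%N -> gcdn d #|F|.-1 = e -> (2 <= e)%N ->
  ((100 * d ^ 12 * (e ^ e.-1 * d) ^ N) ^ 2 <= #|F|)%N ->
  (e ^ N <= num_poly_graphs F d)%N.
Proof.
move=> pp k0 Fpk gd d2 eE e2 bound.
have ed : (e %| d)%N by rewrite -eE dvdn_gcdl.
pose c := (#|F|.-1 %/ e)%N.
have ec : (e * c)%N = #|F|.-1 by rewrite mulnC divnK // -eE dvdn_gcdr.
have Fe : #|F| = (e * c).+1 by rewrite ec prednK // (ltnW (finNzRing_gt1 F)).
have eE' : gcdn d (e * c) = e by rewrite ec.
have d0 : (0 < d)%N := ltnW d2.
have [w wP] := finField_prim_root Fe.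
have H (J : {ffun 'I_N -> 'I_e}) := gap_pattern_exists
  (fun i j => nat_of_bool (J i <= j)%N) pp k0 Fpk Fe gd d2 e2 ed wP bound.
pose x J := projT1 (cid (H J)).
pose f J : F -> F := fun v => v ^+ d + x J.
have count J (i : 'I_N) : preimage_count (f J) (iter (8 + i).+2 (f J) 0) = (J i).+1.
  have [Ox gx] := projT2 (cid (H J)) i.
  exact: (orbit_preimage_count d0 Fe eE' wP Ox (ltn_ord _) gx).
pose h J := functional_graph (f J).
have := @card_equivalence_partition_geq _ {ffun 'I_N -> 'I_e} (@digraph_iso F)
  (poly_graphs F d) h (@digraph_iso_equiv F).
rewrite card_ffun !card_ord; apply=> [J|J1 J2 /functional_graph_isoP[s sE]].
  exact: unicritical_graph.
apply/ffunP => i; apply/val_inj/succn_inj; rewrite -!count.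
rewrite (conj_preimage_count _ sE); congr preimage_count.
exact: (conj_orbit d0 eE' wP _ e2 sE).
Qed.

(** * Asymptotics *)

Local Open Scope classical_set_scope.

Section Asymptotics.

Variables (R : realType) (d : nat).
Hypothesis d2 : (2 <= d)%N.

Let C0 : nat := 100 * d ^ 12.

(** For [q >= C0^2], the largest [N] satisfying the size condition of [num_poly_graphs_geq]; for
    smaller [q] it is 0. *)
Definition level_count (q : nat) : nat :=
  let e := gcdn d q.-1 in trunc_log ((e ^ e.-1 * d) ^ 2) (q %/ C0 ^ 2).

(** Chosen so that [q] to the power [rho] plus this error is exactly [e ^ level_count q]. *)
Definition exponent_error (q : nat) : R :=
  let e := gcdn d q.-1 in (level_count q)%:R * ln e%:R / ln q%:R - rho R d e.

(** With [L = ln (e^(e-1) d)] one has [rho = ln e / (2 L)], and maximality of [N] puts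
    [ln q - 2 N L] between 0 and [2 (ln C0 + L)]. As [ln e] is at most both [L] and [ln d], the
    bound is uniform in [e], which varies with [q]. *)
Lemma exponent_error_bound q :
  (2 <= gcdn d q.-1)%N -> (C0 ^ 2 <= q)%N ->
  `|exponent_error q| <= (ln C0%:R + ln d%:R) / ln q%:R.
Proof.
set e := gcdn d q.-1 => e2 qC.
pose B := (e ^ e.-1 * d)%N; pose N := level_count q.
have C0_gt0 : (0 < C0)%N by rewrite muln_gt0 expn_gt0 (ltnW d2).
have C01 : (1 < C0)%N.
  by apply: (@leq_trans 100); rewrite // /C0 leq_pmulr // expn_gt0 (ltnW d2).
have q1 : (1 < q)%N.
  apply: leq_trans qC; rewrite -mulnn; apply: (leq_trans C01); exact: leq_pmulr.
have B1 : (1 < B)%N.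
  by apply: (leq_trans d2); rewrite /B leq_pmull // expn_gt0 (ltnW e2).
have lnX (a n : nat) : (0 < a)%N -> ln (a ^ n)%:R = n%:R * ln a%:R :> R.
  by move=> a0; rewrite natrX lnXn ?ltr0n // mulr_natl.
have ln_nat_le (a b : nat) : (0 < a)%N -> (a <= b)%N -> ln a%:R <= ln b%:R :> R.
  by move=> a0 ab; rewrite ler_ln ?posrE ?ltr0n ?ler_nat //; apply: leq_trans ab.
have ln_nat_gt0 (a : nat) : (1 < a)%N -> 0 < ln a%:R :> R.
  by move=> a1; rewrite ln_gt0 // ltr1n.
pose L : R := ln B%:R.
have LE : L = (e%:R - 1) * ln e%:R + ln d%:R.
  rewrite /L /B natrM lnM ?posrE ?ltr0n ?expn_gt0 ?(ltnW e2) // ?(ltnW d2) //.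
  by rewrite lnX ?(ltnW e2) // -subn1 natrB // (ltnW e2).
have le0 : 0 < ln e%:R :> R by apply: ln_nat_gt0.
have ld0 : 0 < ln d%:R :> R by apply: ln_nat_gt0.
have lq0 : 0 < ln q%:R :> R by apply: ln_nat_gt0.
have lC0 : 0 < ln C0%:R :> R by apply: ln_nat_gt0.
have L0 : 0 < L by apply: ln_nat_gt0.
have e_le_d : (e <= d)%N by rewrite dvdn_leq ?dvdn_gcdl // ltnW.
have eL : ln e%:R <= L.
  have e2R : 0 <= e%:R - 2 :> R by rewrite subr_ge0 (ler_nat _ 2).
  by have := mulr_ge0 e2R (ltW le0); rewrite LE; lra.
have eld : ln e%:R <= ln d%:R :> R by apply: ln_nat_le => //; exact: ltnW.
have rhoE : rho R d e = ln e%:R / (2 * L).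
  pose X : R := e%:R - 1 + ln d%:R / ln e%:R.
  have LX : L = ln e%:R * X by rewrite LE mulrDr mulrC [X in _ = _ + X]mulrC divfK ?gt_eqF.
  have X0 : X != 0 by move: L0; rewrite LX pmulr_rgt0 // => /gt_eqF->.
  by rewrite /rho -/X LX; field; rewrite X0 gt_eqF.
have B2 : (1 < B ^ 2)%N by rewrite -[1%N]/(1 ^ 2)%N ltn_exp2r.
have qC0 : (0 < q %/ C0 ^ 2)%N by rewrite divn_gt0 ?expn_gt0 ?C0_gt0.
have /andP[NB BN] : ((B ^ 2) ^ N <= q %/ C0 ^ 2 < (B ^ 2) ^ N.+1)%N.
  exact: trunc_log_bounds.
have up : 2 * N%:R * L <= ln q%:R.
  have : ln ((B ^ 2) ^ N)%:R <= ln q%:R :> R.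
    apply: ln_nat_le; first by rewrite !expn_gt0 (ltnW B1).
    by apply: leq_trans NB (leq_div _ _).
  rewrite lnX ?expn_gt0 ?(ltnW B1) // lnX ?(ltnW B1) // -/L; lra.
have low : ln q%:R <= 2 * ln C0%:R + 2 * (N%:R + 1) * L.
  have : ln q%:R <= ln (C0 ^ 2 * (B ^ 2) ^ N.+1)%:R :> R.
    apply: ln_nat_le; first exact: ltnW.
    apply: ltnW; rewrite mulnC -ltn_divLR ?expn_gt0 ?C0_gt0 //.
  rewrite natrM lnM ?posrE ?ltr0n ?expn_gt0 ?C0_gt0 ?(ltnW B1) // !lnX ?expn_gt0 ?(ltnW B1) //.
  by rewrite -/L -natr1; lra.
pose x : R := (ln q%:R - 2 * N%:R * L) / 2; pose t : R := ln e%:R / L.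
have x0 : 0 <= x by rewrite /x; lra.
have xC : x <= ln C0%:R + L by rewrite /x; lra.
have t0 : 0 <= t by rewrite divr_ge0 ?ltW.
have t1 : t <= 1 by rewrite ler_pdivrMr // mul1r.
have Lt : L * t = ln e%:R by rewrite mulrC divfK ?gt_eqF.
have -> : exponent_error q = - (x * t / ln q%:R).
  rewrite /exponent_error -/e rhoE -/N /x /t; field.
  by rewrite !gt_eqF.
rewrite normrN ger0_norm; last by apply: divr_ge0; [exact: mulr_ge0 | exact: ltW].
rewrite ler_pM2r ?invr_gt0 //; apply: (le_trans (ler_wpM2r t0 xC)).
rewrite mulrDl Lt lerD //.
by rewrite -[leRHS]mulr1 ler_wpM2l // ltW.
Qed.

Lemma exponent_error_cvg0 :
  exponent_error q @[q --> within [set q | admissible d q] \oo] --> (0 : R).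
Proof.
apply/cvgrPdist_le => eps eps0.
pose A : R := ln C0%:R + ln d%:R.
have A0 : 0 <= A.
  by rewrite addr_ge0 // ln_ge0 // ler1n ?(ltnW d2) // muln_gt0 expn_gt0 (ltnW d2).
near=> q.
have qA : admissible d q by near: q; exact: withinT.
have [_ _ e2] := qA.
have qC : (C0 ^ 2 <= q)%N.
  near: q; apply: cvg_within; exact: nbhs_infty_ge.
have qE : expR (A / eps) <= q%:R.
  near: q; apply: cvg_within; exact: nbhs_infty_ger.
rewrite sub0r normrN; apply: (le_trans (exponent_error_bound e2 qC)).
have q0 : 0 < q%:R :> R by apply: lt_le_trans qE; exact: expR_gt0.
have lnq : A / eps <= ln q%:R by rewrite -ler_expR lnK.
have q1 : (1 < q)%N.
  apply: leq_trans qC; apply: (@leq_trans (100 ^ 2)) => //.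
  by rewrite leq_sqr /C0 leq_pmulr // expn_gt0 (ltnW d2).
rewrite ler_pdivrMr; first by rewrite mulrC -ler_pdivrMr.
by rewrite ln_gt0 // ltr1n.
Unshelve. all: by end_near.
Qed.

End Asymptotics.

Theorem theorem8 (R : realType) (d : nat) (hd : (2 <= d)%N) :
  exists2 o1 : nat -> R,
    o1 q @[q --> within [set q | admissible d q] \oo] --> (0 : R) &
    forall (q : nat) (F : finFieldType), admissible d q -> #|F| = q ->
      (q%:R : R) `^ (rho R d (gcdn d q.-1) + o1 q)
        <= (num_poly_graphs F d)%:R.
Proof.
exists (exponent_error R d); first exact: exponent_error_cvg0.
move=> q F [[p [k [pp k0 qE]]] gd e2] Fq.
set e := gcdn d q.-1 in e2 *; rewrite /exponent_error -/e addrC subrK.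
set N := level_count d q.
have q1 : (1 < q)%N by rewrite -Fq finNzRing_gt1.
have lq0 : 0 < ln q%:R :> R by rewrite ln_gt0 // ltr1n.
have -> : (q%:R : R) `^ (N%:R * ln e%:R / ln q%:R) = (e ^ N)%:R.
  rewrite /powR pnatr_eq0 gtn_eqF ?(ltnW q1) // divfK ?gt_eqF //.
  by rewrite mulr_natl -lnXn ?ltr0n ?(ltnW e2) // lnK ?natrX // posrE exprn_gt0 // ltr0n ltnW.
rewrite ler_nat.
(* For [N = 0] the claim is only that some graph exists; [q] may then be too small for the size
   condition. *)
have [N0|N0] := posnP N; first by rewrite N0 expn0 num_poly_graphs_gt0.
have q' : (0 < q %/ (100 * d ^ 12) ^ 2)%N.
  by rewrite lt0n; apply: contraTneq N0 => q'; rewrite /N /level_count q' trunc_log0.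
have d0 : (0 < d)%N := ltnW hd.
apply: (num_poly_graphs_geq pp k0 _ _ hd _ e2); rewrite ?Fq //.
rewrite expnMn -!expnM [(N * 2)%N]mulnC expnM mulnC -leq_divRL; last first.
  by rewrite expn_gt0 muln_gt0 expn_gt0 d0.
have B1 : (1 < (e ^ e.-1 * d) ^ 2)%N.
  rewrite -[1%N]/(1 ^ 2)%N ltn_exp2r //; apply: (leq_trans hd).
  by rewrite leq_pmull // expn_gt0 (ltnW e2).
by have /andP[] := trunc_log_bounds B1 q'.
Qed.
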